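(* The following two problems are in PTIME: (a) given a disjunction-free interval multiplicity schema (IMS) $S$ and a twig query $q$, decide whether there exists a tree $t$ with $t\in L(S)$ and $t\models q$; (b) given an IMS $S$ and a twig query $q$, decide whether every tree $t\in L(S)$ satisfies $t\models q$.
   Context: Fix a finite alphabet $\Sigma$ and wildcard $\star\notin\Sigma$. A tree is $t=(N_t,\mathrm{root}_t,\mathit{lab}_t,\mathit{child}_t)$ (unordered, finite, labeled in $\Sigma$, every non-root node has exactly one parent); $\mathit{ch}_t^n:\Sigma\to\mathbb{N}_0$ counts children of $n$ per label. A twig query is $q=(N_q,\mathrm{root}_q,\mathit{lab}_q,\mathit{child}_q,\mathit{desc}_q)$ with $\mathit{lab}_q:N_q\to\Sigma\cup\{\star\}$ and disjoint child/descendant edge sets whose union is acyclic with each non-root node having exactly one predecessor. An embedding of $q$ in $t$ is $\lambda:N_q\to N_t$ with $\lambda(\mathrm{root}_q)=\mathrm{root}_t$, child edges mapped to child edges, descendant edges mapped into $\mathit{child}_t^+$, and $\mathit{lab}_q(n)\in\{\star,\mathit{lab}_t(\lambda(n))\}$; $t\models q$ if one exists. Unordered words are functions $\Sigma\to\mathbb{N}_0$; $\varepsilon$ is the all-zero word; $\uplus$ is multiset union, extended to languages pointwise. Intervals are $[n,m]$ or $[n,m]^?$ with $L(E^{[n,m]})=\{w_1\uplus\dots\uplus w_i\mid n\le i\le m, w_j\in L(E)\}$, $L(E^{[n,m]^?})=L(E^{[n,m]})\cup\{\varepsilon\}$; $*,+,?,1$ denote $[0,\infty],[1,\infty],[0,1],[1,1]$;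 $L(a)=\{a\}$, $L(E_1\mathbin{|\hspace{-0.1em}|} E_2)=L(E_1)\uplus L(E_2)$. An atom is $(a_1^{I_1}\mathbin{|\hspace{-0.1em}|}\dots\mathbin{|\hspace{-0.1em}|} a_k^{I_k})$ with $I_i\in\{?,1\}$; an IME is $A_1^{I_1}\mathbin{|\hspace{-0.1em}|}\dots\mathbin{|\hspace{-0.1em}|} A_k^{I_k}$ with atoms $A_i$, intervals $I_i$, each symbol occurring at most once. An IMS is $S=(\mathrm{root}_S,R_S)$ with $\mathrm{root}_S\in\Sigma$ and $R_S$ mapping symbols to IMEs; $t\in L(S)$ iff $\mathit{lab}_t(\mathrm{root}_t)=\mathrm{root}_S$ and $\mathit{ch}_t^n\in L(R_S(\mathit{lab}_t(n)))$ for all nodes $n$. *)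

(* Defs.v *)
From Stdlib Require Import BinNums BinNat.
From mathcomp Require Import all_boot.

Set Implicit Arguments.
Unset Strict Implicit.
Unset Printing Implicit Defensive.

Definition sym := option bool.   (* None = blank *)

Inductive move := MoveL | MoveR | MoveS.

Record TM := {
  nstates : nat;
  tm_delta : 'I_nstates -> sym -> 'I_nstates * sym * move;
  tm_start : 'I_nstates;
  tm_accept : 'I_nstates;
  tm_reject : 'I_nstates }.

(* tape as a zipper: cells left of the head (nearest first), head, right *)
Record tape := Tape { tleft : seq sym; thead : sym; tright : seq sym }.

Definition tape_move (m : move) (tp : tape) : tape :=
  match m with
  | MoveS => tp
  | MoveL => match tleft tp with
             | [::] => Tape [::] None (thead tp :: tright tp)
             | c :: l => Tape l c (thead tp :: tright tp)
             end
  | MoveR => match tright tp with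
             | [::] => Tape (thead tp :: tleft tp) None [::]
             | c :: r => Tape (thead tp :: tleft tp) c r
             end
  end.

Definition tm_halting (M : TM) (q : 'I_(nstates M)) : bool :=
  (q == tm_accept M) || (q == tm_reject M).

Definition tm_step (M : TM) (c : 'I_(nstates M) * tape)
  : 'I_(nstates M) * tape :=
  let: (q, tp) := c in
  if tm_halting q then c else
  let: (q', w, m) := tm_delta q (thead tp) in
  (q', tape_move m (Tape (tleft tp) w (tright tp))).

Definition tm_init (M : TM) (x : seq bool) : 'I_(nstates M) * tape :=
  (tm_start M,
   match x with
   | [::] => Tape [::] None [::]
   | b :: r => Tape [::] (Some b) (map Some r)
   end).

Definition tm_run (M : TM) (x : seq bool) (n : nat) : 'I_(nstates M) * tape :=
  iter n (@tm_step M) (tm_init M x).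

Definition in_PTIME (I : Type) (enc : I -> seq bool) (dom : I -> Prop)
  (P : I -> Prop) : Prop :=
  exists (M : TM) (c k : nat),
    forall x : I, dom x ->
      exists n : nat,
        n <= c * (size (enc x)) ^ k + c /\
        tm_halting (tm_run M (enc x) n).1 /\
        ((tm_run M (enc x) n).1 = tm_accept M <-> P x).

Section Syntax.
Variable Sigma : finType.

(* finite unordered labeled trees (children list order is irrelevant for
   everything below: only counts of children per label are used) *)
Inductive tree := Node : Sigma -> seq tree -> tree.

Definition tlab (t : tree) : Sigma := let: Node a _ := t in a.
Definition tchildren (t : tree) : seq tree := let: Node _ ts := t in ts.

Fixpoint subtree (t : tree) (p : seq nat) : option tree :=
  match p with
  | [::] => Some t
  | i :: p' =>
      let: Node _ ts := t in
      if i < size ts then subtree (nth t ts i) p' else None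
  end.

Definition tnode (t : tree) (p : seq nat) : Prop := exists s, subtree t p = Some s.

Definition ch (s : tree) : Sigma -> nat :=
  fun a => count (fun u => tlab u == a) (tchildren s).

(* twig queries: label None is the wildcard; each child comes with its
   incoming edge kind: true = child edge, false = descendant edge *)
Inductive twig := QNode : option Sigma -> seq (bool * twig) -> twig.

Definition qlab (q : twig) : option Sigma := let: QNode l _ := q in l.
Definition qchildren (q : twig) : seq (bool * twig) := let: QNode _ cs := q in cs.

Fixpoint subquery (q : twig) (p : seq nat) : option twig :=
  match p with
  | [::] => Some q
  | i :: p' =>
      let: QNode _ cs := q in
      if i < size cs then subquery (nth (true, q) cs i).2 p' else None
  end.

Definition embedding (q : twig) (t : tree) (lam : seq nat -> seq nat) : Prop :=
  lam [::] = [::] /\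
  (forall p qn, subquery q p = Some qn ->
     (exists s, subtree t (lam p) = Some s /\
        (qlab qn = None \/ qlab qn = Some (tlab s))) /\
     (forall i, i < size (qchildren qn) ->
        exists r, r != [::] /\ lam (rcons p i) = lam p ++ r /\
          ((nth (true, qn) (qchildren qn) i).1 -> size r = 1))).

Definition models (t : tree) (q : twig) : Prop := exists lam, embedding q t lam.

Definition word := Sigma -> nat.
Definition lang := word -> Prop.

Definition eps_lang : lang := fun w => forall b, w b = 0.
Definition sym_lang (a : Sigma) : lang := fun w => forall b, w b = (b == a).
Definition uplus_lang (L1 L2 : lang) : lang :=
  fun w => exists w1 w2, L1 w1 /\ L2 w2 /\ forall b, w b = w1 b + w2 b.

Fixpoint iter_lang (L : lang) (i : nat) : lang :=
  match i with
  | 0 => eps_lang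
  | i'.+1 => uplus_lang L (iter_lang L i')
  end.

(* interval [lo, hi] (hi = None means infinity), with the ^? flag *)
Record interval := Interval { ilo : nat; ihi : option nat; iopt : bool }.

Definition interval_lang (I : interval) (L : lang) : lang :=
  fun w => (exists i, ilo I <= i /\
                      (if ihi I is Some m then i <= m else True) /\
                      iter_lang L i w)
           \/ (iopt I /\ eps_lang w).

(* atom (a1^{I1} || ... || ak^{Ik}), Ii in {?, 1}: pair (ai, true) means ai^?,
   (ai, false) means ai^1 *)
Definition atom := seq (Sigma * bool).

Definition atom_lang (A : atom) : lang :=
  foldr (fun (ab : Sigma * bool) (L : lang) =>
           uplus_lang (fun w => sym_lang ab.1 w \/ (ab.2 = true /\ eps_lang w)) L)
        eps_lang A.

(* IME A1^{I1} || ... || Ak^{Ik} *)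
Definition ime := seq (atom * interval).

Definition ime_lang (E : ime) : lang :=
  foldr (fun (AI : atom * interval) (L : lang) => uplus_lang (interval_lang AI.2 (atom_lang AI.1)) L)
        eps_lang E.

Definition wf_ime (E : ime) : bool :=
  uniq (flatten (map (fun AI => map fst AI.1) E)).

Record IMS := MkIMS { ims_root : Sigma; ims_rules : Sigma -> ime }.

Definition wf_IMS (S : IMS) : Prop := forall a, wf_ime (ims_rules S a).

Definition in_IMS (S : IMS) (t : tree) : Prop :=
  tlab t = ims_root S /\
  forall p s, subtree t p = Some s -> ime_lang (ims_rules S (tlab s)) (ch s).

Fixpoint pos_bits (p : positive) : seq bool :=
  match p with
  | xH => [:: true]
  | xO p' => false :: pos_bits p'
  | xI p' => true :: pos_bits p'
  end.

Definition nat_bits (n : nat) : seq bool :=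
  match N.of_nat n with N0 => [::] | Npos p => pos_bits p end.

Definition enc_nat (n : nat) : seq bool :=
  flatten (map (fun b => [:: true; b]) (nat_bits n)) ++ [:: false].

Definition enc_list (T : Type) (f : T -> seq bool) (s : seq T) : seq bool :=
  flatten (map (fun x => true :: f x) s) ++ [:: false].

Definition enc_opt (T : Type) (f : T -> seq bool) (o : option T) : seq bool :=
  if o is Some x then true :: f x else [:: false].

Definition enc_sym (a : Sigma) : seq bool := enc_nat (enum_rank a).

Definition enc_interval (I : interval) : seq bool :=
  enc_nat (ilo I) ++ enc_opt enc_nat (ihi I) ++ [:: iopt I].

Definition enc_atom (A : atom) : seq bool :=
  enc_list (fun ab => enc_sym ab.1 ++ [:: ab.2]) A.

Definition enc_ime (E : ime) : seq bool :=
  enc_list (fun AI => enc_atom AI.1 ++ enc_interval AI.2) E.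

Definition enc_IMS (S : IMS) : seq bool :=
  enc_sym (ims_root S) ++ enc_list (fun a => enc_ime (ims_rules S a)) (enum Sigma).

Fixpoint enc_twig (q : twig) : seq bool :=
  let: QNode l cs := q in
  enc_opt enc_sym l ++
  (fix encs (cs : seq (bool * twig)) : seq bool :=
     match cs with
     | [::] => [:: false]
     | (b, q') :: cs' => true :: b :: enc_twig q' ++ encs cs'
     end) cs.

Definition enc_instance (x : IMS * twig) : seq bool :=
  enc_IMS x.1 ++ enc_twig x.2.

Definition SAT_problem (x : IMS * twig) : Prop :=
  exists t, in_IMS x.1 t /\ models t x.2.

Definition IMPL_problem (x : IMS * twig) : Prop :=
  forall t, in_IMS x.1 t -> models t x.2.

End Syntax.

Arguments enc_instance {Sigma}.
Arguments SAT_problem {Sigma}.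
Arguments IMPL_problem {Sigma}.
Arguments wf_IMS {Sigma}.

(* Main.v *)
From HB Require Import structures.
From Stdlib Require Import BinNat PArith Nnat FunctionalExtensionality.
Require Import Defs.
From mathcomp Require Import all_boot zify.

Set Implicit Arguments.
Unset Strict Implicit.
Unset Printing Implicit Defensive.

(** Without disjunction, the supports (sets of symbols with nonzero
    multiplicity) of the words of an IME form a family closed under union and
    intersection, which depends only on finitely many bits per atom: the required
    and the possible symbols, and whether zero copies, respectively some positive
    number of copies, are allowed.  As embeddings need not be injective, only
    supports matter.  Hence a query is satisfiable iff it embeds into the
    unfolding of the graph of possible children among productive symbols, and is
    implied iff the root is not productive or the query embeds into the unfolding
    of the graph of necessary children; both are evaluated bottom-up over the
    query.

    As the alphabet is fixed, these graphs fit in the finite control of a machine.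
    A Turing machine simulates a queue automaton: a first pass tokenizes the input,
    and each further pass rotates the queue once.  Passes first compare the
    interval bounds, consuming one binary digit of each bound per pass, then
    contract the query, absorbing evaluated nodes into their parents. *)

(** * Turing machines simulating bit queues *)

(** The shape of the bound is the one that [in_PTIME] asks for. *)
Definition poly_bounded (f : nat -> nat) : Prop :=
  exists c k, forall m, f m <= c * m ^ k + c.

Lemma poly_bounded_const c : poly_bounded (fun=> c).
Proof. by exists c, 0 => m; rewrite leq_addl. Qed.

Lemma poly_bounded_id : poly_bounded id.
Proof. by exists 1, 1 => m; rewrite expn1 mul1n leq_addr. Qed.

(** The [+ 1] covers [m = 0] with [k = 0 < l], where [0 ^ 0 = 1] exceeds [0 ^ l = 0]. *)
Lemma leq_expn1 m k l : k <= l -> m ^ k <= m ^ l + 1.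
Proof.
move=> kl; case: m => [|m]; first by case: k kl => [|k] _; rewrite ?expn0 ?leq_addl // exp0n.
by apply: leq_trans (leq_addr _ _); rewrite leq_pexp2l.
Qed.

Lemma poly_bounded_add f g :
  poly_bounded f -> poly_bounded g -> poly_bounded (fun m => f m + g m).
Proof.
move=> [c [k Hf]] [d [l Hg]]; exists (c + c + d + d), (maxn k l) => m.
have Ek := leq_expn1 m (leq_maxl k l); have El := leq_expn1 m (leq_maxr k l).
have := Hf m; have := Hg m; move: Ek El.
move: (m ^ k) (m ^ l) (m ^ maxn k l) => x y z; nia.
Qed.

Lemma poly_bounded_mul f g :
  poly_bounded f -> poly_bounded g -> poly_bounded (fun m => f m * g m).
Proof.
(* With [x = m ^ k] and [y = m ^ l], the bounds multiply to [c * d * (x * y + x + y + 1)], and [x]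
   and [y] are each at most [x * y + 1]; the factor 5 leaves room. *)
move=> [c [k Hf]] [d [l Hg]]; exists (5 * c * d), (k + l) => m.
have Ek := leq_expn1 m (leq_addr l k); have El := leq_expn1 m (leq_addl k l).
apply: leq_trans (leq_mul (Hf m) (Hg m)) _; move: Ek El; rewrite expnD.
by move: (m ^ k) (m ^ l) => x y; nia.
Qed.

(** * Machines whose states form an arbitrary finite type *)

Section FinTM.
Variables (St : finType) (delta : St -> sym -> St * sym * move).
Variables (start acc rej : St).

Definition fin_halting s := (s == acc) || (s == rej).

Definition fin_step (c : St * tape) : St * tape :=
  let: (s, tp) := c in
  if fin_halting s then c else
  let: (s', w, m) := delta s (Defs.thead tp) in
  (s', tape_move m (Tape (tleft tp) w (tright tp))).

Definition tm_of_fin : TM :=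
  {| tm_delta := fun i c => let: (s, w, m) := delta (enum_val i) c in
                            (enum_rank s, w, m);
     tm_start := enum_rank start; tm_accept := enum_rank acc;
     tm_reject := enum_rank rej |}.

Definition fin_lift (c : St * tape) : 'I_(nstates tm_of_fin) * tape :=
  (enum_rank c.1, c.2).

Lemma halting_tm_of_fin s :
  @tm_halting tm_of_fin (enum_rank s) = fin_halting s.
Proof. by rewrite /tm_halting /= !(inj_eq enum_rank_inj). Qed.

Lemma step_tm_of_fin c : @tm_step tm_of_fin (fin_lift c) = fin_lift (fin_step c).
Proof.
case: c => s tp; rewrite /tm_step /fin_step {1}/fin_lift halting_tm_of_fin.
case: ifP => // _ /=; rewrite enum_rankK.
by case: (delta s _) => [[s' w] m].
Qed.

Lemma run_tm_of_fin n c :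
  iter n (@tm_step tm_of_fin) (fin_lift c) = fin_lift (iter n fin_step c).
Proof. by elim: n => //= n ->; rewrite step_tm_of_fin. Qed.

End FinTM.

(** Reading through [nth None] ignores blanks at the far ends, which a zipper may or may not
    store. *)
Definition teq (a b : tape) : Prop :=
  [/\ Defs.thead a = Defs.thead b,
      forall i, nth None (tleft a) i = nth None (tleft b) i &
      forall i, nth None (tright a) i = nth None (tright b) i].

Lemma teq_refl a : teq a a. Proof. by []. Qed.

Lemma teq_sym a b : teq a b -> teq b a.
Proof. by case=> h l r; split=> // i; rewrite ?l ?r. Qed.

Lemma teq_trans b a c : teq a b -> teq b c -> teq a c.
Proof.
by move=> [h l r] [h' l' r']; split=> [|i|i]; rewrite ?h ?l ?r.
Qed.

Lemma teq_move m w a b : teq a b ->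
  teq (tape_move m (Tape (tleft a) w (tright a)))
      (tape_move m (Tape (tleft b) w (tright b))).
Proof.
have cons_nth (x : sym) s s' : (forall i, nth None s i = nth None s' i) ->
    forall i, nth None (x :: s) i = nth None (x :: s') i by move=> e [|i] /=.
case: a b => [l h r] [l' h' r'] [/= _ el er]; case: m; last by split.
- have e0 := el 0; have eS i := el i.+1.
  by case: l l' {el} e0 eS => [|x l] [|x' l'] /= e0 eS; rewrite ?e0 -?e0; split=> //= i;
    rewrite -?eS -?[RHS]eS ?nth_nil // (cons_nth w _ _ er).
- have e0 := er 0; have eS i := er i.+1.
  by case: r r' {er} e0 eS => [|x r] [|x' r'] /= e0 eS; rewrite ?e0 -?e0; split=> //= i;
    rewrite -?eS -?[RHS]eS ?nth_nil // (cons_nth w _ _ el).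
Qed.

Section Reach.
Variables (St : finType) (delta : St -> sym -> St * sym * move).
Variables (acc rej : St).
Notation step := (fin_step delta acc rej).

(** The step count is only an upper bound and tapes are taken up to [teq], so that runs compose with
    additive bounds. *)
Definition reaches n (c c' : St * tape) : Prop :=
  exists m, [/\ m <= n, (iter m step c).1 = c'.1 & teq (iter m step c).2 c'.2].

Lemma teq_step s a b : teq a b ->
  (step (s, a)).1 = (step (s, b)).1 /\ teq (step (s, a)).2 (step (s, b)).2.
Proof.
move=> ab; rewrite /fin_step; case: ifP => //= _.
have [-> _ _] := ab; case: (delta s _) => [[s' w] m] /=.
by split=> //; apply: teq_move.
Qed.

Lemma teq_iter n s a b : teq a b ->
  (iter n step (s, a)).1 = (iter n step (s, b)).1 /\
  teq (iter n step (s, a)).2 (iter n step (s, b)).2.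
Proof.
move=> ab; elim: n => [|n]; first by [].
rewrite !iterS; case: (iter n _ _) => s1 a1; case: (iter n _ _) => s2 a2 /=.
by case=> -> /(teq_step s2).
Qed.

Lemma reaches_teq s a b : teq a b -> reaches 0 (s, a) (s, b).
Proof. by move=> ab; exists 0. Qed.

Lemma reaches_trans c' n m c c'' :
  reaches n c c' -> reaches m c' c'' -> reaches (n + m) c c''.
Proof.
case: c' => s' a' [i [/= lei ei ti]] [j [lej ej tj]].
exists (j + i); split; first by rewrite addnC leq_add.
  rewrite iterD -ej; move: ei ti; case: (iter i _ _) => s b /= -> tb.
  by case: (teq_iter j s' tb).
rewrite iterD; apply: teq_trans tj; move: ei ti; case: (iter i _ _) => s b /= -> tb.
by case: (teq_iter j s' tb).
Qed.

Lemma reaches_leq n m c c' : n <= m -> reaches n c c' -> reaches m c c'.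
Proof. by move=> nm [i [lei ei ti]]; exists i; split=> //; apply: leq_trans nm. Qed.

Lemma reaches_step s tp s' w m tp' : ~~ fin_halting acc rej s ->
  delta s (Defs.thead tp) = (s', w, m) ->
  teq (tape_move m (Tape (tleft tp) w (tright tp))) tp' ->
  reaches 1 (s, tp) (s', tp').
Proof.
by move=> ns ed et; exists 1; split=> //=; rewrite (negPf ns) ed.
Qed.

End Reach.

(** A head with the cells [s] at and to the right of it (padded with blanks),
    and dually with the cells [l] at and to the left of it. *)
Definition rtape (l s : seq sym) : tape := Tape l (head None s) (behead s).
Definition ltape (l s : seq sym) : tape := Tape (behead l) (head None l) s.

Lemma move_rtape l w s :
  tape_move MoveR (Tape l w s) = rtape (w :: l) s.
Proof. by case: s. Qed.

Lemma move_ltape l w s :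
  tape_move MoveL (Tape l w s) = ltape l (w :: s).
Proof. by case: l. Qed.

Section BitQueue.
(** [f] is the change of state when the raw input is exhausted; from then on [d]
    consumes the bits that it appended before. *)
Variables (Q : finType) (d : Q -> bool -> Q * seq bool) (f : Q -> Q).
Variable verdict : Q -> option bool.

(** The longest output of [d] on one bit; it bounds the words carried in the control, which keeps
    the state type finite. *)
Let K := \max_(x : Q * bool) size (d x.1 x.2).2.

Lemma insub_bseqE n (T : Type) (s : seq T) : size s <= n -> insub_bseq n s = s :> seq T.
Proof. by move=> sn; rewrite /insub_bseq /insubd insubT. Qed.

Lemma size_bq q b : size (d q b).2 <= K.
Proof.
exact: (leq_bigmax (F := fun x : Q * bool => size (d x.1 x.2).2) (q, b)).
Qed.

(** The two boolean parameters of [Fwd] and [Bwd] say whether a separating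
    blank remains to be crossed, and whether the raw input is still there. *)
Inductive bq_state :=
  | Halt of bool
  | Pop of bool & Q
  | Fwd of bool & bool & Q & {bseq K of bool}
  | Write of bool & Q & {bseq K of bool}
  | Bwd of bool & bool & Q.

Definition bq_code (s : bq_state) :
    bool + (bool * Q) + (bool * bool * Q * {bseq K of bool}) +
    (bool * Q * {bseq K of bool}) + (bool * bool * Q) :=
  match s with
  | Halt v => inl (inl (inl (inl v)))
  | Pop p q => inl (inl (inl (inr (p, q))))
  | Fwd j p q u => inl (inl (inr (j, p, q, u)))
  | Write p q u => inl (inr (p, q, u))
  | Bwd j p q => inr (j, p, q)
  end.

Definition bq_decode c : bq_state :=
  match c with
  | inl (inl (inl (inl v))) => Halt v
  | inl (inl (inl (inr (p, q)))) => Pop p q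
  | inl (inl (inr (j, p, q, u))) => Fwd j p q u
  | inl (inr (p, q, u)) => Write p q u
  | inr (j, p, q) => Bwd j p q
  end.

Lemma bq_codeK : cancel bq_code bq_decode. Proof. by case. Qed.

HB.instance Definition _ := Finite.copy bq_state (can_type bq_codeK).

(** A cycle erases the leftmost bit, carries the output to the right end, writes it there and
    returns; the erased cell is the blank that stops the way back. In the raw phase, popping the
    separating blank triggers [f]. *)
Definition bq_delta (s : bq_state) (c : sym) : bq_state * sym * move :=
  match s with
  | Halt v => (Halt v, c, MoveS)
  | Pop p q =>
      if verdict q is Some v then (Halt v, c, MoveS) else
      if c is Some b then (Fwd p p (d q b).1 (insub_bseq K (d q b).2), None, MoveR)
      else (Pop false (f q), None, MoveR)
  | Fwd j p q u =>
      if c is Some _ then (Fwd j p q u, c, MoveR)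
      else if j then (Fwd false p q u, None, MoveR)
      else (Write p q u, None, MoveS)
  | Write p q u =>
      if (u : seq bool) is b :: _ then (Write p q (insub_bseq K (behead u)), Some b, MoveR)
      else (Bwd p p q, c, MoveL)
  | Bwd j p q =>
      if c is Some _ then (Bwd j p q, c, MoveL)
      else if j then (Bwd false p q, None, MoveL)
      else (Pop p q, None, MoveR)
  end.

Notation bq_reaches := (reaches bq_delta (Halt true) (Halt false)).

Local Ltac tm_step_by e :=
  apply: reaches_step; [by [] | by rewrite /= ?e /=; reflexivity |
    rewrite ?move_rtape ?move_ltape; try exact: teq_refl].

Local Ltac tm_step :=
  apply: reaches_step; [by [] | reflexivity |
    rewrite ?move_rtape ?move_ltape; try exact: teq_refl].

Lemma reaches_fwd j p q u l v s :
  bq_reaches (size v) (Fwd j p q u, rtape l (map Some v ++ s))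
                      (Fwd j p q u, rtape (rev (map Some v) ++ l) s).
Proof.
elim: v l => [|b v IHv] l; first exact: reaches_teq.
rewrite -[size _]/(1 + size v) /= rev_cons cat_rcons.
apply: reaches_trans (IHv (Some b :: l)).
by tm_step.
Qed.

Lemma reaches_write p q (u : {bseq K of bool}) l :
  bq_reaches (size u + 1) (Write p q u, rtape l [::])
    (Bwd p p q, ltape (rev (map Some u) ++ l) [::]).
Proof.
move: {2}(u : seq bool) (erefl (u : seq bool)) => v.
elim: v u l => [|b v IHv] u l eu.
  rewrite eu; tm_step_by eu.
  by split=> // -[|i] /=; rewrite ?nth_nil.
have eu' : insub_bseq K (behead u) = v :> seq bool.
    by rewrite insub_bseqE eu //; apply: ltnW; rewrite -[_ < _]/(size (b :: v) <= K) -eu size_bseq.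
have {IHv} := IHv (insub_bseq K (behead u)) (Some b :: l) eu'.
rewrite eu' eu -[size (b :: v)]/(1 + size v) -addnA /= rev_cons cat_rcons => IHv.
apply: reaches_trans IHv; by tm_step_by eu.
Qed.

Lemma reaches_bwd j p q l v s :
  bq_reaches (size v) (Bwd j p q, ltape (rev (map Some v) ++ l) s)
                      (Bwd j p q, ltape l (map Some v ++ s)).
Proof.
elim/last_ind: v s => [|v b IHv] s; first exact: reaches_teq.
rewrite size_rcons map_rcons rev_rcons cat_rcons -add1n.
apply: reaches_trans (IHv (Some b :: s)).
by tm_step.
Qed.

Definition raw_tape (raw que : seq bool) : tape :=
  rtape [::] (map Some raw ++ None :: map Some que).
Definition que_tape (que : seq bool) : tape := rtape [::] (map Some que).

Lemma teq_blank_left (s : seq sym) : teq (rtape [:: None] s) (rtape [::] s).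
Proof. by split=> // -[|[|i]]. Qed.

Lemma teq_blank_right l (s : seq sym) :
  teq (rtape l (s ++ [:: None])) (rtape l s).
Proof.
case: s => [|x s]; first by split=> // -[|i].
by split=> //= i; rewrite -[in RHS](cats0 s) !nth_cat; case: ifP => // _; case: (i - _) => [|[]].
Qed.

Lemma reaches_raw q b raw que : verdict q = None ->
  bq_reaches (2 * (size raw + size que + size (d q b).2) + 9)
    (Pop true q, raw_tape (b :: raw) que)
    (Pop true (d q b).1, raw_tape raw (que ++ (d q b).2)).
Proof.
move=> vq; set u := (d q b).2; set q' := (d q b).1.
set U := insub_bseq K u.
have eU : U = u :> seq bool.
  by rewrite insub_bseqE ?size_bq.
pose R := map Some raw; pose l := None :: rev R ++ [:: None].
(* In order: pop, cross the input, the separator and the queue, switch to writing, write, then go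
   back over the queue, the separator and the input, and step right. *)
apply: reaches_leq
  (_ : 1 + (size raw + (1 + (size que + (1 + ((size U + 1) + (size (que ++ u) +
         (1 + (size raw + 1)))))))) <= _) _.
  by rewrite eU size_cat; lia.
apply: (reaches_trans (c' := (Fwd true true q' U, rtape [:: None] (R ++ None :: map Some que)))).
  by tm_step_by vq.
apply: reaches_trans (reaches_fwd _ _ _ _ _ _ _) _.
apply: (reaches_trans (c' := (Fwd false true q' U, rtape l (map Some que)))).
  by tm_step.
rewrite -[map Some que]cats0.
apply: reaches_trans (reaches_fwd _ _ _ _ _ _ _) _.
apply: (reaches_trans (c' := (Write true q' U, rtape (rev (map Some que) ++ l) [::]))).
  by tm_step.
apply: reaches_trans (reaches_write _ _ _ _) _.
rewrite eU catA -rev_cat -map_cat.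
apply: reaches_trans (reaches_bwd _ _ _ _ _ _) _.
apply: (reaches_trans (c' := (Bwd false true q', ltape (rev R ++ [:: None])
    (None :: map Some (que ++ u) ++ [::])))).
  by tm_step.
apply: reaches_trans (reaches_bwd _ _ _ _ _ _) _.
by tm_step; rewrite ?cats0; apply: teq_blank_left.
Qed.

Lemma reaches_que q b que : verdict q = None ->
  bq_reaches (2 * (size que + size (d q b).2) + 9)
    (Pop false q, que_tape (b :: que))
    (Pop false (d q b).1, que_tape (que ++ (d q b).2)).
Proof.
move=> vq; set u := (d q b).2; set q' := (d q b).1.
set U := insub_bseq K u.
have eU : U = u :> seq bool.
  by rewrite insub_bseqE ?size_bq.
apply: reaches_leq
  (_ : 1 + (size que + (1 + ((size U + 1) + (size (que ++ u) + 1)))) <= _) _.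
  by rewrite eU size_cat; lia.
apply: (reaches_trans (c' := (Fwd false false q' U, rtape [:: None] (map Some que)))).
  by tm_step_by vq.
rewrite -[map Some que]cats0.
apply: reaches_trans (reaches_fwd _ _ _ _ _ _ _) _.
apply: (reaches_trans (c' := (Write false q' U, rtape (rev (map Some que) ++ [:: None]) [::]))).
  by tm_step.
apply: reaches_trans (reaches_write _ _ _ _) _.
rewrite eU catA -rev_cat -map_cat.
apply: reaches_trans (reaches_bwd _ _ _ _ _ _) _.
by tm_step; rewrite ?cats0; apply: teq_blank_left.
Qed.

Lemma reaches_raw_end q que : verdict q = None ->
  bq_reaches 1 (Pop true q, raw_tape [::] que) (Pop false (f q), que_tape que).
Proof.
move=> vq; by tm_step_by vq; apply: teq_blank_left.
Qed.

Fixpoint bq_raw_state (q : Q) (raw : seq bool) : Q :=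
  if raw is b :: raw' then bq_raw_state (d q b).1 raw' else q.

Fixpoint bq_raw_out (q : Q) (raw : seq bool) : seq bool :=
  if raw is b :: raw' then (d q b).2 ++ bq_raw_out (d q b).1 raw' else [::].

Definition bq_step (c : Q * seq bool) : Q * seq bool :=
  if verdict c.1 is Some _ then c else
  if c.2 is b :: que then ((d c.1 b).1, que ++ (d c.1 b).2) else c.

Lemma size_bq_raw_out q raw : size (bq_raw_out q raw) <= K * size raw.
Proof.
elim: raw q => //= b raw IHraw q.
by rewrite size_cat mulnS leq_add // size_bq.
Qed.

Lemma reaches_raw_run q raw que :
  (forall r1 r2, raw = r1 ++ r2 -> verdict (bq_raw_state q r1) = None) ->
  bq_reaches (size raw * (2 * (size raw + (size que + K * size raw)) + 9) + 1)
    (Pop true q, raw_tape raw que)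
    (Pop false (f (bq_raw_state q raw)), que_tape (que ++ bq_raw_out q raw)).
Proof.
elim: raw q que => [|b raw IHraw] q que vq.
  by rewrite cats0; apply: reaches_raw_end; apply: (vq [::]).
have vq0 := vq [::] _ erefl; have v' r1 r2 : raw = r1 ++ r2 ->
    verdict (bq_raw_state (d q b).1 r1) = None.
  by move=> er; apply: (vq (b :: r1) r2); rewrite er.
have := reaches_trans (reaches_raw b raw que vq0) (IHraw _ (que ++ (d q b).2) v').
rewrite /= catA; apply: reaches_leq.
have := size_bq q b; rewrite size_cat; move: (size raw) (size que) (size _) => x y z.
by nia.
Qed.

Lemma reaches_verdict n q que v : verdict (iter n bq_step (q, que)).1 = Some v ->
  exists tp, bq_reaches (n * (2 * (size que + K * n) + 9) + 1)
    (Pop false q, que_tape que) (Halt v, tp).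
Proof.
elim: n q que => [|n IHn] q que vn.
  exists (que_tape que).
  by tm_step_by vn.
case vq : (verdict q) => [v'|].
  (* A verdict freezes the configuration, so the final verdict is already the present one. *)
  have st m : iter m bq_step (q, que) = (q, que).
    by elim: m => //= m ->; rewrite /bq_step /= vq.
  move: vn; rewrite st /= vq => -[<-]; exists (que_tape que).
  apply: (@reaches_leq _ _ _ _ 1); first by rewrite leq_addl.
  by tm_step_by vq.
move: vn; rewrite iterSr /bq_step /= vq -/bq_step.
case: que => [|b que] vn.
  (* On an empty queue the automaton is stuck without a verdict, against [vn]. *)
  exfalso; suff: verdict (iter n bq_step (q, [::])).1 = None by rewrite vn.
  have -> : iter n bq_step (q, [::]) = (q, [::]).
    by elim: n {vn IHn} => //= m ->; rewrite /bq_step /= vq.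
  by [].
have [tp Htp] := IHn _ _ vn; exists tp.
apply: reaches_leq (reaches_trans (reaches_que b que vq) Htp).
have := size_bq q b; rewrite size_cat /=; move: (size que) (size _) => x y; nia.
Qed.

Definition bq_tm q0 : TM := tm_of_fin bq_delta (Pop true q0) (Halt true) (Halt false).

Lemma bq_decides q0 x n v :
  (forall r1 r2, x = r1 ++ r2 -> verdict (bq_raw_state q0 r1) = None) ->
  verdict (iter n bq_step (f (bq_raw_state q0 x), bq_raw_out q0 x)).1 = Some v ->
  exists m,
    [/\ m <= size x * (2 * (size x + K * size x) + 9) +
             n * (2 * (K * size x + K * n) + 9) + 2,
        tm_halting (tm_run (bq_tm q0) x m).1 &
        (tm_run (bq_tm q0) x m).1 = tm_accept (bq_tm q0) <-> v].
Proof.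
move=> vx vn.
have [tp Htp] := reaches_verdict vn.
have := reaches_trans (reaches_raw_run [::] vx) Htp.
have t0 : teq (tm_init (bq_tm q0) x).2 (raw_tape x [::]).
  (* With an empty queue only the separator follows the input, and a trailing blank is invisible to
     [teq]. *)
  rewrite /raw_tape; apply: teq_trans (teq_sym (teq_blank_right _ _)).
  by case: x {vx vn Htp} => [|b x] //=.
have := reaches_trans (reaches_teq _ _ _ _ t0).
move=> H /H{H} [m [lem em _]].
exists m; rewrite /tm_run /=.
have -> : tm_init (bq_tm q0) x =
    fin_lift _ _ _ _ (Pop true q0, (tm_init (bq_tm q0) x).2) by [].
rewrite run_tm_of_fin /fin_lift em; split.
- apply: leq_trans lem _.
  have := size_bq_raw_out q0 x; rewrite /=; move: (size _) (size x) => y z; nia.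
- by rewrite halting_tm_of_fin /fin_halting; case: (v); rewrite eqxx ?orbT.
- by case: v {vn Htp em}; split=> // /enum_rank_inj.
Qed.

End BitQueue.

(** * Queue automata over a finite alphabet *)

Section LetterQueue.
Variables (Gamma Q1 Q2 : finType).
Variables (d1 : Q1 -> bool -> Q1 * seq Gamma) (q1 : Q1).
Variables (d2 : Q2 -> Gamma -> Q2 * seq Gamma) (q2 : Q2).
Variable verdict : Q2 -> option bool.

Fixpoint transduce (q : Q1) (s : seq bool) : seq Gamma :=
  if s is b :: s' then (d1 q b).2 ++ transduce (d1 q b).1 s' else [::].

Definition queue_step (c : Q2 * seq Gamma) : Q2 * seq Gamma :=
  if verdict c.1 is Some _ then c else
  if c.2 is g :: s then ((d2 c.1 g).1, s ++ (d2 c.1 g).2) else c.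

(** A unary, self-delimiting code, decoded by a counter that fits in the control. *)
Definition code (g : Gamma) : seq bool := nseq (enum_rank g) true ++ [:: false].
Definition codes (s : seq Gamma) : seq bool := flatten (map code s).

Local Notation BQ := (Q1 + (Q2 * 'I_(#|Gamma|.+1)))%type.

Definition code_delta (q : BQ) (b : bool) : BQ * seq bool :=
  match q with
  | inl q => (inl (d1 q b).1, codes (d1 q b).2)
  | inr (q, i) =>
      if b then (inr (q, inord i.+1), [::])
      else if [pick g | enum_rank g == i :> nat] is Some g
           then (inr ((d2 q g).1, ord0), codes (d2 q g).2)
           else (inr (q, ord0), [::])
  end.

Definition code_fin (_ : BQ) : BQ := inr (q2, ord0).
Definition code_verdict (q : BQ) : option bool :=
  if q is inr (q, _) then verdict q else None.

Notation bstep := (bq_step code_delta code_verdict).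

Lemma codes_cat s t : codes (s ++ t) = codes s ++ codes t.
Proof. by rewrite /codes map_cat flatten_cat. Qed.

Lemma bq_raw_out_transduce q s :
  bq_raw_out code_delta (inl q) s = codes (transduce q s).
Proof. by elim: s q => //= b s IHs q; rewrite IHs codes_cat. Qed.

Lemma code_step q g s : verdict q = None ->
  exists2 m, m <= #|Gamma|.+1 &
    iter m bstep (inr (q, ord0), code g ++ s) =
    (inr ((d2 q g).1, ord0), s ++ codes (d2 q g).2).
Proof.
move=> vq; pose r : nat := enum_rank g.
have ltr : r < #|Gamma| by apply: ltn_ord.
exists r.+1; first exact: leqW.
have H k : k <= r -> iter k bstep (inr (q, ord0), code g ++ s) =
    (inr (q, inord k), nseq (r - k) true ++ [:: false] ++ s).
  elim: k => [|k IHk] ltk.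
    by rewrite subn0 /= -catA; congr (inr (_, _), _); apply: val_inj; rewrite /= inordK.
  rewrite iterS IHk 1?ltnW // -(subnSK ltk) /= /bq_step /= vq cats0.
  rewrite inordK; last by apply: leqW; apply: leq_trans ltk (ltnW ltr).
  by [].
rewrite iterS H // subnn /bq_step /= vq.
rewrite inordK; last by apply: ltnW.
case: pickP => [g' /eqP|/(_ g)]; last by rewrite eqxx.
by move=> /val_inj/enum_rank_inj ->.
Qed.

Lemma bq_of_queue n q s v : verdict (iter n queue_step (q, s)).1 = Some v ->
  exists2 m, m <= n * #|Gamma|.+1 &
    code_verdict (iter m bstep (inr (q, ord0), codes s)).1 = Some v.
Proof.
elim: n q s => [|n IHn] q s vn; first by exists 0.
move: vn; rewrite iterSr.
case vq : (verdict q) => [v'|]; rewrite /queue_step /= vq -/queue_step.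
  by move=> /IHn[m lem em]; exists m => //; apply: leq_trans lem _; rewrite leq_pmul2r.
case: s => [|g s].
  by move=> /IHn[m lem em]; exists m => //; apply: leq_trans lem _; rewrite leq_pmul2r.
move=> /IHn[m lem em]; have [k lek ek] := code_step g (codes s) vq.
exists (m + k); first by rewrite mulSn addnC leq_add.
by rewrite iterD ek -codes_cat.
Qed.

(** A letter costs at most [#|Gamma|.+1] bit steps, and a bit step costs a walk over a tape whose
    length is linear in the input size and the number of bit steps. *)
Lemma in_PTIME_queue (I : Type) (enc : I -> seq bool) (dom P : I -> Prop) N :
  poly_bounded N ->
  (forall x, dom x -> exists n v,
     [/\ n <= N (size (enc x)),
         verdict (iter n queue_step (q2, transduce q1 (enc x))).1 = Some v &
         v <-> P x]) ->
  in_PTIME enc dom P.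
Proof.
move=> polyN H; pose K := \max_(x : BQ * bool) size (code_delta x.1 x.2).2.
pose C := #|Gamma|.+1.
pose T m := m * (2 * (m + K * m) + 9) + N m * C * (2 * (K * m + K * (N m * C)) + 9) + 2.
have [c [k Hck]] : poly_bounded T.
  have cst := poly_bounded_const; have idp := poly_bounded_id.
  by do ?[exact: cst | exact: idp | exact: polyN |
          apply: poly_bounded_add | apply: poly_bounded_mul].
exists (bq_tm code_delta code_fin code_verdict (inl q1)), c, k => x dx.
have [n [v [len vn vP]]] := H x dx.
have [m lem vm] := bq_of_queue vn.
have := @bq_decides _ code_delta code_fin code_verdict (inl q1) (enc x) m v.
case=> [r1 r2 _||t [let_ ht vt]].
- suff [q ->] : exists q, bq_raw_state code_delta (inl q1) r1 = inl q by [].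
  by elim: r1 q1 => [|b r IHr] q; [exists q | apply: IHr].
- by rewrite bq_raw_out_transduce.
exists t; split; last by split=> //; rewrite vt.
apply: leq_trans let_ (leq_trans _ (Hck _)).
rewrite -/K leq_add2r leq_add2l.
have lemN : m <= N (size (enc x)) * C by apply: leq_trans lem _; rewrite leq_pmul2r.
by apply: leq_mul => //; rewrite leq_add2r leq_mul2l /= leq_add2l leq_mul2l lemN orbT.
Qed.

End LetterQueue.

(** * Supports of words *)

Lemma interval_codeK : cancel (fun I => (ilo I, ihi I, iopt I))
                              (fun x => Interval x.1.1 x.1.2 x.2).
Proof. by case. Qed.

HB.instance Definition _ := Equality.copy interval (can_type interval_codeK).

Section Supports.
Variable Sigma : finType.
Implicit Types (A : atom Sigma) (E : ime Sigma) (w : word Sigma) (T : {set Sigma}).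

(** Required symbols, all symbols, whether zero copies of the atom are allowed,
    and whether some positive number of copies is. *)
Definition row : finType := ({set Sigma} * {set Sigma} * bool * bool)%type.

(** Copies of an atom choose their optional symbols independently and share the required ones, so
    every positive number of copies constrains the support in the same way. *)
Definition realizable (r : row) T : bool :=
  let: (R, U, z, s) := r in (z && [disjoint U & T]) || (s && (R \subset T)).

Definition row_syms (r : row) : {set Sigma} := r.1.1.2.

Definition family (rs : {set row}) : {set {set Sigma}} :=
  [set T : {set Sigma} | [forall r in rs, realizable r T] &&
                         (T \subset \bigcup_(r in rs) row_syms r)].

Definition reqs A : {set Sigma} := [set a | (a, false) \in A].
Definition syms A : {set Sigma} := [set a | a \in map fst A].

Definition some_ok (I : interval) : bool :=
  if ihi I is Some m then (ilo I <= m) && (0 < m) else true.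

Definition row_of (AI : atom Sigma * interval) : row :=
  (reqs AI.1, syms AI.1, (ilo AI.2 == 0) || iopt AI.2, some_ok AI.2).

Definition rows E : {set row} := [set r in map row_of E].

Definition supp w : {set Sigma} := [set b | 0 < w b].

(** If one of the two sets realizes an atom with a positive number of copies, so does the union;
    otherwise both sets avoid the atom. *)
Lemma familyU rs T1 T2 : T1 \in family rs -> T2 \in family rs -> T1 :|: T2 \in family rs.
Proof.
rewrite !inE => /andP[/forall_inP H1 s1] /andP[/forall_inP H2 s2].
apply/andP; split; last by rewrite subUset s1.
apply/forall_inP => r rr; move: (H1 r rr) (H2 r rr); case: r {rr} => [[[R U] z] s] /=.
case/orP=> /andP[-> d1]; last first.
  by move=> _; apply/orP; right; apply: subset_trans d1 _; apply: subsetUl.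
case/orP=> [d2|/andP[-> d2]]; last first.
  by apply/orP; right; apply: subset_trans d2 _; apply: subsetUr.
by rewrite -setI_eq0 setIUr setU_eq0 !setI_eq0 d1 d2.
Qed.

(** Dually, if one of the two sets avoids an atom, so does the intersection; otherwise both contain
    the required symbols. *)
Lemma familyI rs T1 T2 : T1 \in family rs -> T2 \in family rs -> T1 :&: T2 \in family rs.
Proof.
rewrite !inE => /andP[/forall_inP H1 s1] /andP[/forall_inP H2 s2].
apply/andP; split; last by apply: subset_trans s1; apply: subsetIl.
apply/forall_inP => r rr; move: (H1 r rr) (H2 r rr); case: r {rr} => [[[R U] z] s] /=.
case/orP=> /andP[-> /= d1]; first by move=> _; apply/orP; left; exact: disjointWr (subsetIl _ _) d1.
case/orP=> [/andP[-> d2]|d2]; first by apply/orP; left; exact: disjointWr (subsetIr _ _) d2.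
by rewrite subsetI d1 d2 orbT.
Qed.

Lemma atom_lang_supp A w : atom_lang A w -> reqs A \subset supp w /\ supp w \subset syms A.
Proof.
elim: A w => [|[a f] A IHA] w /=.
  by move=> w0; split; apply/subsetP => b; rewrite !inE // w0.
move=> [w1 [w2 [L1 [/IHA[/subsetP R2 /subsetP S2] ew]]]]; split; apply/subsetP => b.
  rewrite !inE ew => /orP[/eqP[-> ef]|bA].
    by case: L1 => [->|[]]; rewrite ?eqxx // -ef.
  by rewrite ltn_addl //; have := R2 b; rewrite !inE; apply.
rewrite !inE ew addn_gt0 => /orP[] b0.
  by case: L1 => [L1|[_ L1]]; move: b0; rewrite L1 //; case: eqP => [->|//]; rewrite ?eqxx.
by rewrite orbC; have := S2 b; rewrite !inE b0 => ->.
Qed.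

Lemma iter_lang_supp A i w : iter_lang (atom_lang A) i.+1 w ->
  reqs A \subset supp w /\ supp w \subset syms A.
Proof.
elim: i w => [|i IHi] w [w1 [w2 [/atom_lang_supp[R1 S1] [L2 ew]]]].
  have -> : supp w = supp w1 by apply/setP => b; rewrite !inE ew L2 addn0.
  by [].
have [R2 S2] := IHi _ L2.
have -> : supp w = supp w1 :|: supp w2 by apply/setP => b; rewrite !inE ew addn_gt0.
by rewrite subUset S1 S2 (subset_trans R1) // subsetUl.
Qed.

Lemma interval_lang_supp A I w : interval_lang I (atom_lang A) w ->
  supp w \subset syms A /\ realizable (row_of (A, I)) (supp w).
Proof.
have eps : (forall b, w b = 0) -> supp w = set0.
  by move=> w0; apply/setP => b; rewrite !inE w0.
case=> [[[|i] [lo_i [i_hi L]]]|[o L]].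
- rewrite eps // sub0set; split=> //=.
  by move: lo_i; rewrite leqn0 => ->; rewrite disjoint_sym disjoints_subset sub0set.
- have [R S] := iter_lang_supp L; split=> //=; rewrite R andbT /some_ok.
  by apply/orP; right; case: (ihi I) i_hi => // m im; rewrite (leq_trans lo_i im) (leq_trans _ im).
- rewrite eps // sub0set; split=> //=.
  by rewrite o orbT disjoint_sym disjoints_subset sub0set.
Qed.

(** As symbols do not repeat, the support of the whole word, cut down to the symbols of one atom, is
    the support of the contribution of that atom. *)
Lemma ime_lang_supp E w : wf_ime E -> ime_lang E w -> supp w \in family (rows E).
Proof.
rewrite /wf_ime => uE Lw.
have: supp w \subset [set a in flatten [seq map fst AI.1 | AI <- E]] /\
      {in map row_of E, forall r, realizable r (supp w)}.
  elim: E w uE Lw => [|[A I] E IHE] w /=.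
    by move=> _ w0; split=> //; apply/subsetP => b; rewrite !inE w0.
  rewrite cat_uniq => /and3P[_ /hasPn dj uE] [w1 [w2 [L1 [L2 ew]]]].
  have [/subsetP S1 R1] := interval_lang_supp L1; have [/subsetP S2 R2] := IHE _ uE L2.
  have ->: supp w = supp w1 :|: supp w2 by apply/setP => b; rewrite !inE ew addn_gt0.
  split.
    apply/subsetP => b; rewrite in_setU inE mem_cat => /orP[/S1|/S2]; rewrite inE => -> //.
    by rewrite orbT.
  have d2 A' I' : (A', I') \in E ->
      {subset syms A' <= [set a in flatten [seq map fst AI.1 | AI <- E]]}.
    move=> AE b; rewrite !inE => bA; apply/flattenP.
    by exists (map fst A') => //; apply/mapP; exists (A', I').
  (* Realizability depends only on the trace of the set on the symbols of the row. *)
  have ext X Y (r : row) : row_syms r :&: X = row_syms r :&: Y -> r.1.1.1 \subset row_syms r ->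
      realizable r X -> realizable r Y.
    case: r => [[[R U] z] s] /= eXY RU; rewrite /row_syms /= in eXY RU.
    have sub (Z : {set Sigma}) : (R \subset Z) = (R \subset U :&: Z) by rewrite subsetI RU.
    by rewrite -!setI_eq0 (sub X) (sub Y) eXY.
  have req_sub A' : reqs A' \subset syms A'.
    by apply/subsetP => b; rewrite !inE => /(map_f fst).
  move=> r; rewrite inE => /orP[/eqP->|/[dup] rE /R2].
    apply: ext R1; last exact: req_sub.
    apply/setP => b; rewrite !inE.
    case: (boolP (b \in map fst A)) => //= bA; case: posnP => //= _.
    apply/esym/negbTE; apply/negP => b2; have := S2 b; rewrite !inE => /(_ b2).
    by move=> /dj; rewrite bA.
  case/mapP: rE => -[A' I'] AE ->; apply: ext; last exact: req_sub.
  apply/setP => b; rewrite !inE.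
  case: (boolP (b \in map fst A')) => //= bA.
  have bE : b \in flatten [seq map fst AI.1 | AI <- E].
    by have := d2 _ _ AE b; rewrite !inE => /(_ bA).
  case: (posnP (w1 b)) => //= b1; have := S1 b; rewrite !inE => /(_ b1) bA1.
  by have := dj _ bE; rewrite bA1.
case=> S H; rewrite inE; apply/andP; split.
  by apply/forall_inP => r; rewrite inE => /H.
apply: subset_trans S _; apply/subsetP => b; rewrite inE => /flattenP[s /mapP[AI AIE ->] bs].
apply/bigcupP; exists (row_of AI); first by rewrite inE map_f.
by rewrite /row_syms /= inE.
Qed.

(** * From supports back to words *)

Definition select T A : word Sigma := fun b => count (fun ab => (ab.1 == b) && (b \in T)) A.

Lemma select_gt0 T A b : (0 < select T A b) = (b \in T) && (b \in syms A).
Proof.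
rewrite -has_count inE; apply/hasP/andP => [[ab abA /andP[/eqP<- ->]]|[bT /mapP[ab abA eb]]].
  by split=> //; apply: map_f.
by exists ab => //; rewrite -eb eqxx.
Qed.

Lemma select_lang T A : reqs A \subset T -> atom_lang A (select T A).
Proof.
elim: A => [|[a f] A IHA] //= /subsetP RT.
exists (fun b => (a == b) && (b \in T) : nat), (select T A); split; last split=> //.
  case: (boolP (a \in T)) => aT.
    by left=> b; rewrite eq_sym; case: eqP => [->|//]; rewrite aT.
  right; split; last by move=> b; case: eqP => // <-; rewrite (negPf aT).
  by case: f RT => // /(_ a); rewrite !inE eqxx => /(_ isT); rewrite (negPf aT).
by apply: IHA; apply/subsetP => b; have := RT b; rewrite !inE => + bA; rewrite bA orbT; apply.
Qed.

Lemma realize_interval A I T : realizable (row_of (A, I)) T ->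
  exists2 w, interval_lang I (atom_lang A) w &
             forall b, (0 < w b) = (b \in T) && (b \in syms A).
Proof.
move=> /= /orP[/andP[z dj]|/andP[s RT]].
  exists (fun=> 0) => [|b]; last first.
    apply/esym/negbTE/negP => /andP[bT bA].
    by move: dj; rewrite -setI_eq0 => /eqP/setP/(_ b); rewrite in_setI in_set0 bA bT.
  case/orP: z => [/eqP z|o]; last by right.
  by left; exists 0; rewrite z; split=> //; split=> //; case: ihi.
(* The least positive number of copies allowed by the lower bound, all copies being equal; [some_ok]
   keeps it below the upper bound. *)
exists (fun b => maxn 1 (ilo I) * select T A b) => [|b]; last first.
  by rewrite muln_gt0 select_gt0 leq_max.
left; exists (maxn 1 (ilo I)); split; first exact: leq_maxr.
split; first by move: s; rewrite /some_ok; case: ihi => // m /andP[lm m0]; rewrite geq_max m0.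
elim: (maxn _ _) => [|i IHi] /=; first by move=> b; rewrite mul0n.
by exists (select T A), (fun b => i * select T A b); split; [apply: select_lang|split].
Qed.

(** A converse to [ime_lang_supp]: words realizing the set on each atom are added up, and their
    supports cover it. *)
Lemma realize_ime E T : T \in family (rows E) ->
  exists2 w, ime_lang E w & forall b, (0 < w b) = (b \in T).
Proof.
rewrite inE => /andP[/forall_inP H /subsetP S].
suff [w Lw Hw] : exists2 w, ime_lang E w & forall b, (0 < w b) =
    (b \in T) && (b \in \bigcup_(r in rows E) row_syms r).
  by exists w => // b; rewrite Hw; case: (boolP (b \in T)) => // /S ->.
elim: E {S} H => [|[A I] E IHE] H.
  by exists (fun=> 0) => // b; rewrite /rows big1 ?inE ?andbF // => r; rewrite inE.
have [r rE|w2 L2 W2] := IHE; first by apply: H; rewrite !inE in rE *; rewrite rE orbT.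
have [|w1 L1 W1] := @realize_interval A I T; first by apply: H; rewrite !inE eqxx.
exists (fun b => w1 b + w2 b) => [|b]; first by exists w1, w2.
rewrite addn_gt0 W1 W2 -andb_orr; congr (_ && _).
apply/orP/bigcupP => [[bA|/bigcupP[r rE br]]|[r]].
- by exists (row_of (A, I)); rewrite // !inE eqxx.
- by exists r => //; rewrite !inE in rE *; rewrite rE orbT.
- rewrite !inE => /orP[/eqP->|rE] br; first by left; move: br; rewrite /row_syms /= !inE.
  by right; apply/bigcupP; exists r => //; rewrite inE.
Qed.

Lemma ime_lang_ext E w w' : (forall b, w b = w' b) -> ime_lang E w -> ime_lang E w'.
Proof.
move=> ew; case: E => [|AI E] /=; first by move=> w0 b; rewrite -ew.
by move=> [w1 [w2 [L1 [L2 e]]]]; exists w1, w2; split=> //; split=> // b; rewrite -ew.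
Qed.

End Supports.

(** * Embeddings into trees and graphs *)

Section Trees.
Variable Sigma : finType.
Implicit Types (t u s : tree Sigma) (q : twig Sigma) (r : rel Sigma) (a b : Sigma).

(** The recursion is nested in [seq], so the principle is built by hand, with children given by
    index as in [subtree]. *)
Lemma tree_nth_ind (P : tree Sigma -> Prop) :
  (forall a ts, (forall i, i < size ts -> P (nth (Node a ts) ts i)) -> P (Node a ts)) ->
  forall t, P t.
Proof.
move=> H; fix IH 1 => -[a ts]; apply: H; move: (Node a ts) => t0.
elim: ts => [|t ts IHts] i; first (rewrite ltn0; discriminate).
case: i => [_|i]; [exact: IH | exact: IHts].
Qed.

Lemma twig_nth_ind (P : twig Sigma -> Prop) :
  (forall l cs, (forall i d, i < size cs -> P (nth d cs i).2) -> P (QNode l cs)) ->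
  forall q, P q.
Proof.
move=> H; fix IH 1 => -[l cs]; apply: H => + d.
elim: cs => [|[e q] cs IHcs] i; first (rewrite ltn0; discriminate).
case: i => [_|i]; [exact: IH | exact: IHcs].
Qed.

Lemma subtree_cat t p s p' : subtree t p = Some s -> subtree t (p ++ p') = subtree s p'.
Proof.
elim: p t => [|i p IHp] t /=; first by case=> ->.
by case: t => a ts; case: ifP => // _; apply: IHp.
Qed.

Lemma subtree_consP t i p s : subtree t (i :: p) = Some s ->
  exists2 u, subtree t [:: i] = Some u & subtree u p = Some s.
Proof. by case: t => a ts /=; case: ifP => // _ H; exists (nth (Node a ts) ts i). Qed.

Lemma nat_choice (T : Type) n (P : nat -> T -> Prop) (x0 : T) :
  (forall i, i < n -> exists x, P i x) -> exists g, forall i, i < n -> P i (g i).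
Proof.
elim: n => [|n IHn] H; first by exists (fun=> x0).
have [i lti|g Hg] := IHn; first by apply: H; apply: ltnW.
have [x Hx] := H n (ltnSn n); exists (fun i => if i == n then x else g i) => i.
by rewrite ltnS leq_eqVlt; case: eqP => [-> //|_] /= /Hg.
Qed.

(** Restricting an embedding to a child subquery and cutting off the path to the image of that child
    gives an embedding; conversely, embeddings of the children are glued by prefixing such paths. *)
Lemma models_node t l cs : models t (QNode l cs) <->
  (l = None \/ l = Some (tlab t)) /\
  forall i, i < size cs -> exists p s,
    [/\ p != [::], subtree t p = Some s,
        (nth (true, QNode l cs) cs i).1 -> size p = 1 &
        models s (nth (true, QNode l cs) cs i).2].
Proof.
set d := (true, QNode l cs); split.
  move=> [lam [lam0 H]]; have [[s [st ls]] _] := H [::] _ erefl.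
  move: st; rewrite lam0 => -[est]; rewrite -est in ls; split=> // i lti.
  have [_ /(_ i lti)[p0 [p0n [ep0 sz0]]]] := H [::] _ erefl; rewrite /= lam0 /= in ep0.
  have subq p : subquery (QNode l cs) (i :: p) = subquery (nth d cs i).2 p by rewrite /= lti.
  have [[s0 [st0 _]] _] := H [:: i] _ (subq [::]); rewrite ep0 in st0.
  exists p0, s0; split=> //.
  (* Each edge lengthens the image path, so all images below child [i] extend the image [p0] of that
     child. *)
  have pre p qn : subquery (nth d cs i).2 p = Some qn ->
      lam (i :: p) = p0 ++ drop (size p0) (lam (i :: p)).
    elim/last_ind: p qn => [|p j IHp] qn sq; first by rewrite ep0 drop_size cats0.
    have [q' [sq' ltj]] : exists q', subquery (nth d cs i).2 p = Some q' /\ j < size (qchildren q').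
      move: sq; rewrite -cats1; move: (nth d cs i).2 => q'.
      elim: p q' {IHp} => [|k p IHp] [l' cs'] /=; last by case: ifP => // _ /IHp.
      by case: ifP => // ltj _; exists (QNode l' cs').
    have [_ /(_ j ltj)[r [_ [er _]]]] := H (i :: p) _ (etrans (subq p) sq').
    rewrite -rcons_cons er (IHp _ sq') -catA; congr (_ ++ _).
    by rewrite drop_size_cat.
  exists (fun p => drop (size p0) (lam (i :: p))); split; first by rewrite ep0 drop_size.
  move=> p qn sq; have [[s' [st' ls']] Hc] := H (i :: p) _ (etrans (subq p) sq).
  split.
    by exists s'; split=> //; rewrite -(subtree_cat _ st0) -(pre _ _ sq).
  move=> j ltj; have [r [rn [er szr]]] := Hc j ltj; exists r; split=> //; split=> //.
  rewrite -rcons_cons er (pre _ _ sq) -catA !drop_size_cat //.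
move=> [ls H].
have [g Hg] : exists g : nat -> seq nat * (seq nat -> seq nat), forall i, i < size cs ->
    exists s, [/\ (g i).1 != [::], subtree t (g i).1 = Some s,
      (nth d cs i).1 -> size (g i).1 = 1 & embedding (nth d cs i).2 s (g i).2].
  pose P i (x : seq nat * (seq nat -> seq nat)) := exists s,
    [/\ x.1 != [::], subtree t x.1 = Some s,
        (nth d cs i).1 -> size x.1 = 1 & embedding (nth d cs i).2 s x.2].
  apply: (@nat_choice _ _ P ([::], id)) => i /H[p [s [pn st sz [lam Hl]]]].
  by exists (p, lam), s.
exists (fun p => if p is i :: p' then (g i).1 ++ (g i).2 p' else [::]); split=> // -[|i p] qn.
  case=> <-; split; first by exists t.
  move=> i /= lti; have [s [pn st sz [l0 _]]] := Hg i lti.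
  by exists (g i).1; rewrite l0 cats0.
rewrite /=; case: ifP => // lti.
have [s [pn st sz [l0 Hs]]] := Hg i lti.
move=> sq; have [[s' [st' ls']] Hc] := Hs p qn sq; split.
  by exists s'; rewrite (subtree_cat _ st).
by move=> j /Hc[r [rn [er szr]]]; exists r; rewrite er catA.
Qed.

(** * Evaluation of queries on graphs of labels *)

Definition descends r a b := [exists c, r a c && connect r c b].

Definition parents r (e : bool) (X : {set Sigma}) : {set Sigma} :=
  [set a | [exists b in X, if e then r a b else descends r a b]].

Definition labels (l : option Sigma) : {set Sigma} :=
  if l is Some a then [set a] else setT.

(** The labels at which a query embeds into the infinite unfolding of the graph [r]. *)
Fixpoint roots r q : {set Sigma} :=
  let: QNode l cs := q in
  foldl (fun X c => X :&: parents r c.1 (roots r c.2)) (labels l) cs.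

Lemma in_roots r a l cs d : reflect
  (a \in labels l /\ forall i, i < size cs ->
     a \in parents r (nth d cs i).1 (roots r (nth d cs i).2))
  (a \in roots r (QNode l cs)).
Proof.
rewrite /=; elim: cs (labels l) => [|c cs IHcs] X /=; first by apply: (iffP idP) => // -[].
apply: (iffP (IHcs _)) => [[]|[aX H]].
  by rewrite inE => /andP[aX ac] H; split=> // -[|i] //; apply: H.
by rewrite inE aX (H 0); split=> // i lti; apply: (H i.+1).
Qed.

Definition edges_in r t := forall p s i u,
  subtree t p = Some s -> subtree s [:: i] = Some u -> r (tlab s) (tlab u).

Lemma edges_in_subtree r t p s : edges_in r t -> subtree t p = Some s -> edges_in r s.
Proof. by move=> H st p' s' i u st'; apply: (H (p ++ p')); rewrite (subtree_cat _ st). Qed.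

Lemma edges_in_node r a ts :
  (forall i, i < size ts -> r a (tlab (nth (Node a ts) ts i)) /\
                            edges_in r (nth (Node a ts) ts i)) ->
  edges_in r (Node a ts).
Proof.
move=> H [|j p] s i u.
  by case=> <- /=; case: ifP => // lti [<-]; case: (H i lti).
by rewrite [subtree _ _]/=; case: ifP => // ltj; apply: (proj2 (H j ltj)).
Qed.

Lemma edges_in_connect r t p s : edges_in r t -> subtree t p = Some s ->
  connect r (tlab t) (tlab s).
Proof.
elim: p t => [|i p IHp] t Ht; first by case=> ->; apply: connect0.
case/subtree_consP=> u tu us; have := IHp u (edges_in_subtree Ht tu) us.
by apply: connect_trans; apply: connect1; apply: (Ht [::]) tu.
Qed.

(** Labelling maps the tree into the graph [r], sending proper descents to nonempty paths; it is
    composed with the embedding. *)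
Lemma models_roots r q t : edges_in r t -> models t q -> tlab t \in roots r q.
Proof.
elim/twig_nth_ind: q t => l cs IHq t Ht /models_node[ll H].
apply/(in_roots _ _ _ _ (true, QNode l cs)); split.
  by case: ll => -> /=; rewrite inE.
move=> i lti; have [p [s [pn st sz ms]]] := H i lti.
rewrite inE; apply/existsP; exists (tlab s).
rewrite IHq //=; last exact: edges_in_subtree st.
case: p pn sz st => // j p _ sz st; have [u tu us] := subtree_consP st.
have tu1 := Ht [::] _ _ _ erefl tu.
case: (nth _ _ _).1 sz => [/(_ isT)[]|_].
  by move/eqP; rewrite size_eq0 => /eqP ep; move: us; rewrite ep => -[<-].
apply/existsP; exists (tlab u); rewrite tu1 /=.
exact: edges_in_connect (edges_in_subtree Ht tu) us.
Qed.

(** A finite substitute for containing the infinite unfolding of [r]: its branches are all present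
    down to depth [n]. *)
Fixpoint full r n t : Prop :=
  if n is n'.+1 then forall b, r (tlab t) b ->
    exists i u, [/\ subtree t [:: i] = Some u, tlab u = b & full r n' u]
  else True.

Lemma full_leq r m n t : m <= n -> full r n t -> full r m t.
Proof.
elim: m n t => [|m IHm] [|n] t // mn H b /H[i [u [tu ub fu]]].
by exists i, u; split=> //; apply: IHm fu.
Qed.

Lemma full_path r n p t : path r (tlab t) p -> full r (size p + n) t ->
  exists p' s, [/\ size p' = size p, subtree t p' = Some s,
                   tlab s = last (tlab t) p & full r n s].
Proof.
elim: p t => [|b p IHp] t /=; first by move=> _ ft; exists [::], t.
move=> /andP[tb pb] /(_ b tb)[i [u [tu ub fu]]]; rewrite -ub in pb.
have [p' [s [sz us es fs]]] := IHp u pb fu.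
exists (i :: p'), s; split=> //; first by rewrite /= sz.
  by rewrite -cat1s (subtree_cat _ (tu : subtree t [:: i] = Some u)).
by rewrite es ub.
Qed.

(** A depth at which the query fits when each of its edges takes at most [#|Sigma|.+1] tree
    edges. *)
Fixpoint fullness q : nat :=
  let: QNode l cs := q in
  foldr (fun c m => maxn (fullness c.2 + #|Sigma|.+1) m) 0 cs.

Lemma roots_models r q t : full r (fullness q) t -> tlab t \in roots r q -> models t q.
Proof.
elim/twig_nth_ind: q t => l cs IHq t; set d := (true, QNode l cs) => ft.
case/(in_roots _ _ _ _ d) => tl H; apply/models_node; split.
  by case: l tl {d IHq H ft} => [a|] /=; [rewrite inE => /eqP->; right | left].
move=> i lti; have := H i lti; rewrite inE => /existsP[b /andP[bq tb]]; rewrite -/d.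
have {}ft : full r (fullness (nth d cs i).2 + #|Sigma|.+1) t.
  apply: full_leq ft => /=; elim: (cs) i lti {H bq tb} => [|c cs' IHcs] [|i] //=.
    by rewrite leq_maxl.
  by move=> /IHcs H; rewrite leq_max H orbT.
have [p [pt ep szp szp1]] : exists p,
    [/\ path r (tlab t) p, last (tlab t) p = b, 0 < size p <= #|Sigma|.+1 &
        (nth d cs i).1 -> size p = 1].
  move: tb; case: (nth d cs i).1 => [tb|].
    by exists [:: b]; rewrite /= tb.
  (* Loops after the first edge are cut, so the symbols met from [c] on are distinct and number at
     most [#|Sigma|]. *)
  move=> /existsP[c /andP[tc /connectP[p pc ->]]]; case: (shortenP pc) => p' pc' up _.
  have szp : size (c :: p') <= #|Sigma| by rewrite -(card_uniqP up) max_card.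
  by exists (c :: p'); split=> //; [rewrite /= tc | apply: leqW szp].
case/andP: szp => szp0 szp.
have {ft} := full_leq (_ : size p + fullness (nth d cs i).2 <= _) ft.
rewrite [_ + #|_|.+1]addnC leq_add2r => /(_ szp)/(full_path pt)[p' [s [sz ts es fs]]].
exists p', s; split=> //.
- by rewrite -size_eq0 sz -lt0n.
- by move=> /szp1; rewrite sz.
by apply: IHq => //; rewrite es ep.
Qed.

End Trees.

(** * Satisfiability and implication in terms of families of supports *)

Section Schema.
Variable Sigma : finType.
Implicit Types (F : Sigma -> {set {set Sigma}}) (X T : {set Sigma}).

Definition prod_step F X : {set Sigma} :=
  [set a | [exists T in F a, T \subset X]].

Definition productive F : {set Sigma} := fixset (prod_step F).

(** All of [T], not only [b], must be productive: the siblings of [b] have to be completed to finite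
    trees too. *)
Definition may_child F : rel Sigma :=
  fun a b => [exists T in F a, (T \subset productive F) && (b \in T)].

(** Members of [F a] with unproductive symbols count as well: by closure under intersection, the
    least member lies inside any productive one. *)
Definition must_child F : rel Sigma := fun a b => [forall T in F a, b \in T].

Lemma productiveE F : prod_step F (productive F) = productive F.
Proof.
apply: fixsetK => X Y XY; apply/subsetP => a; rewrite !inE.
case/existsP=> T /andP[TF TX]; apply/existsP; exists T.
by rewrite TF (subset_trans TX).
Qed.

Variable S : IMS Sigma.
Hypothesis wfS : wf_IMS S.

Let F a := family (rows (ims_rules S a)).

Definition conforms (t : tree Sigma) : Prop := forall p s,
  subtree t p = Some s -> ime_lang (ims_rules S (tlab s)) (ch s).

Lemma conforms_subtree t p s : conforms t -> subtree t p = Some s -> conforms s.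
Proof. by move=> H st p' s' ss; apply: (H (p ++ p')); rewrite (subtree_cat _ st). Qed.

Lemma conforms_node a ts : ime_lang (ims_rules S a) (ch (Node a ts)) ->
  (forall i, i < size ts -> conforms (nth (Node a ts) ts i)) -> conforms (Node a ts).
Proof.
move=> La H [|i p] s; first by case=> <-.
by rewrite /=; case: ifP => // lti; apply: H.
Qed.

Lemma ch_gt0 (t : tree Sigma) b :
  reflect (exists i u, subtree t [:: i] = Some u /\ tlab u = b) (0 < ch t b).
Proof.
case: t => a ts; rewrite /ch /= -has_count; apply: (iffP idP).
  move=> hb; pose i := find (fun u => tlab u == b) ts.
  have lti : i < size ts by rewrite -has_find.
  by exists i, (nth (Node a ts) ts i); rewrite lti; split=> //; apply/eqP/(nth_find (Node a ts) hb).
move=> [i [u [/=]]]; case: ifP => // lti [<-] <-.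
by apply/(has_nthP (Node a ts)); exists i.
Qed.

Lemma conforms_supp t : conforms t -> supp (ch t) \in F (tlab t).
Proof. by move=> Ht; apply: ime_lang_supp; [apply: wfS | apply: (Ht [::])]. Qed.

Lemma conforms_productive t : conforms t -> tlab t \in productive F.
Proof.
elim/tree_nth_ind: t => a ts IHt Ht; rewrite -productiveE inE.
apply/existsP; exists (supp (ch (Node a ts))); rewrite (conforms_supp Ht) /=.
apply/subsetP => b; rewrite inE => /ch_gt0[i [u [tu <-]]].
have cu := conforms_subtree Ht tu.
by move: tu cu => /=; case: ifP => // lti [<-]; apply: IHt.
Qed.

Lemma conforms_may t : conforms t -> edges_in (may_child F) t.
Proof.
move=> Ht p s i u ts su; have Hs := conforms_subtree Ht ts.
apply/existsP; exists (supp (ch s)); rewrite conforms_supp //=; apply/andP; split.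
  apply/subsetP => b; rewrite inE => /ch_gt0[j [v [sv <-]]].
  by apply: conforms_productive; apply: conforms_subtree sv.
by rewrite inE; apply/ch_gt0; exists i, u.
Qed.

Lemma conforms_must n t : conforms t -> full (must_child F) n t.
Proof.
elim: n t => [|n IHn] t Ht //= b /forall_inP/(_ _ (conforms_supp Ht)).
rewrite inE => /ch_gt0[i [u [tu ub]]]; exists i, u; split=> //.
by apply: IHn; apply: conforms_subtree tu.
Qed.

Lemma build_node a T (P : tree Sigma -> Prop) : T \in F a ->
  (forall b, b \in T -> exists t, tlab t = b /\ P t) ->
  exists ts, [/\ ime_lang (ims_rules S a) (ch (Node a ts)),
    forall d i, i < size ts -> tlab (nth d ts i) \in T /\ P (nth d ts i) &
    forall d b, b \in T -> exists2 i, i < size ts & tlab (nth d ts i) = b].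
Proof.
move=> TF H; have [w Lw Hw] := realize_ime TF.
have [g Hg] : exists g : Sigma -> tree Sigma, forall b,
    tlab (g b) = b /\ (b \in T -> P (g b)).
  apply: (fin_all_exists (P := fun b t => tlab t = b /\ (b \in T -> P t))) => b.
  case: (boolP (b \in T)) => [/H[t [tb Pt]]|_]; first by exists t.
  (* Outside [T] any tree labelled [b] will do, since [w b = 0] there. *)
  by exists (Node b [::]).
pose ts := flatten [seq nseq (w b) (g b) | b <- enum Sigma].
have cnt (p : pred (tree Sigma)) : count p ts = \sum_b p (g b) * w b.
  rewrite /ts count_flatten -map_comp sumnE big_map big_enum /=.
  by apply: eq_bigr => b _; rewrite count_nseq.
have chE b : ch (Node a ts) b = w b.
  rewrite /ch /= cnt (bigD1 b) //= big1 ?addn0 => [|c cb].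
    by rewrite (Hg b).1 eqxx mul1n.
  by rewrite (Hg c).1 (negPf cb).
have inT d b : b \in T -> exists2 i, i < size ts & tlab (nth d ts i) = b.
  rewrite -Hw -chE => /ch_gt0[i [u [/=]]]; case: ifP => // lti [<-] <-.
  by exists i => //; rewrite (set_nth_default (Node a ts)).
exists ts; split=> [|d i lti|]; last exact: inT.
  by apply: ime_lang_ext Lw => b; rewrite chE.
have [b bT ->] : exists2 b, b \in T & nth d ts i = g b.
  move: lti; rewrite /ts; elim: (enum Sigma) i {ts cnt chE inT} => //= b s IHs i.
  rewrite size_cat nth_cat size_nseq; case: (ltnP i (w b)) => [lti _|lei lti].
    by exists b; [rewrite -Hw (leq_ltn_trans _ lti) | rewrite nth_nseq lti].
  by apply: IHs; rewrite ltn_subLR.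
by rewrite (Hg b).1; split=> //; apply: (Hg b).2.
Qed.

Lemma productive_conforms a : a \in productive F -> exists t, tlab t = a /\ conforms t.
Proof.
rewrite /productive /fixset; elim: #|Sigma| a => [|n IHn] a; first by rewrite inE.
rewrite iterS inE => /existsP[T /andP[TF /subsetP TX]].
have [ts [L H _]] := build_node TF (fun b bT => IHn b (TX b bT)).
exists (Node a ts); split=> //; apply: conforms_node => // i lti.
by case: (H (Node a ts) i lti).
Qed.

(** Closure under union gives a largest member of [F a] made of productive symbols; using it at each
    node provides all possible children at once. *)
Lemma may_tree n a : a \in productive F ->
  exists t, tlab t = a /\ (conforms t /\ full (may_child F) n t).
Proof.
elim: n a => [|n IHn] a aG.
  by have [t [ta ct]] := productive_conforms aG; exists t.
pose P T := (T \in F a) && (T \subset productive F).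
have [T0 PT0] : exists T, P T.
  by move: aG; rewrite -productiveE inE => /existsP[T TP]; exists T.
have [T /maxsetP[/andP[TF TG] Tmax] _] := maxset_exists PT0.
have [ts [L H1 H2]] := build_node TF (fun b bT => IHn b (subsetP TG b bT)).
exists (Node a ts); split=> //; split.
  by apply: conforms_node => // i lti; case: (H1 (Node a ts) i lti) => _ [].
move=> b /existsP[T' /andP[TF' /andP[TG' bT']]].
have bT : b \in T.
  by rewrite -(Tmax (T :|: T')) ?subsetUl ?inE ?bT' ?orbT // /P familyU // subUset TG.
have [i lti ib] := H2 (Node a ts) b bT.
exists i, (nth (Node a ts) ts i); rewrite /= lti; split=> //.
by case: (H1 (Node a ts) i lti) => _ [].
Qed.

(** The tree is pruned: below the support at each node lies a minimal member of [F a], which closure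
    under intersection makes the least one, so every child kept is necessary. *)
Lemma must_tree t : conforms t ->
  exists t', tlab t' = tlab t /\ (conforms t' /\ edges_in (must_child F) t').
Proof.
elim/tree_nth_ind: t => a ts IHt Ht.
have [T /minsetP[TF Tmin] TS] := minset_exists (P := fun T => T \in F a) (conforms_supp Ht).
have sub b : b \in T -> exists t', tlab t' = b /\ (conforms t' /\ edges_in (must_child F) t').
  move=> /(subsetP TS); rewrite inE => /ch_gt0[i [u [tu <-]]].
  have cu := conforms_subtree Ht tu.
  by move: tu cu => /=; case: ifP => // lti [<-]; apply: IHt.
have [us [L H _]] := build_node TF sub.
exists (Node a us); split=> //; split.
  by apply: conforms_node => // i lti; case: (H (Node a us) i lti) => _ [].
apply: edges_in_node => i lti; have [bT [_ He]] := H (Node a us) i lti; split=> //.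
apply/forall_inP => T' TF'.
have eT : T :&: T' = T by apply: Tmin; [apply: familyI | apply: subsetIl].
by move: bT; rewrite -eT inE => /andP[].
Qed.

(** Conforming trees have only [may_child] edges, and [may_tree] realizes all of these down to the
    depth that the query uses. *)
Lemma SAT_characterization q : SAT_problem (S, q) <->
  (ims_root S \in productive F) && (ims_root S \in roots (may_child F) q).
Proof.
split=> [[t [/= [<- ct] mt]]|/andP[rG rq]].
  by rewrite conforms_productive // (models_roots (conforms_may ct)).
have [t [tr [ct ft]]] := may_tree (fullness q) rG.
by exists t; split; [split | apply: roots_models ft _; rewrite tr].
Qed.

(** Every conforming tree contains the unfolding of [must_child] to any depth, and the pruned tree
    of [must_tree] has no other edges. *)
Lemma IMPL_characterization q : IMPL_problem (S, q) <->
  (ims_root S \in productive F) ==> (ims_root S \in roots (must_child F) q).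
Proof.
split=> [H|/implyP H t [/= tr ct]].
  apply/implyP => rG; have [t [tr ct]] := productive_conforms rG.
  have [t' [tr' [ct' et']]] := must_tree ct.
  by rewrite -tr -tr'; apply: models_roots et' _; apply: H; split=> //=; rewrite tr'.
apply: roots_models (conforms_must _ ct) _; rewrite tr; apply: H; rewrite -tr.
exact: conforms_productive.
Qed.

End Schema.

(** * Tokenizing an instance *)

Fixpoint bits_val (l : seq bool) : nat := if l is b :: l' then b + 2 * bits_val l' else 0.

Lemma bits_val_pos p : bits_val (pos_bits p) = Pos.to_nat p.
Proof.
elim: p => // p IHp; rewrite ?Pos2Nat.inj_xI ?Pos2Nat.inj_xO [LHS]/= IHp; lia.
Qed.

Lemma bits_val_nat n : bits_val (nat_bits n) = n.
Proof.
rewrite /nat_bits -[in RHS](Nat2N.id n); case: (N.of_nat n) => //= p.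
exact: bits_val_pos.
Qed.

(** Lets the tokenizer recognise a zero bound by its lack of digits. *)
Lemma nilp_nat_bits n : nilp (nat_bits n) = (n == 0).
Proof.
case: n => [|n] //; apply/negbTE/negP => /nilP e.
by have := bits_val_nat n.+1; rewrite e.
Qed.

Definition enc_bits (l : seq bool) : seq bool :=
  flatten [seq [:: true; b] | b <- l] ++ [:: false].

Lemma enc_natE n : enc_nat n = enc_bits (nat_bits n). Proof. by []. Qed.

Lemma enc_bits_inj l1 l2 s1 s2 : enc_bits l1 ++ s1 = enc_bits l2 ++ s2 -> l1 = l2 /\ s1 = s2.
Proof.
elim: l1 l2 => [|b1 l1 IH] [|b2 l2] //=; first by case=> ->.
by case=> -> /IH[-> ->].
Qed.

Lemma enc_list_cons (T : Type) (f : T -> seq bool) x s t :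
  enc_list f (x :: s) ++ t = true :: f x ++ enc_list f s ++ t.
Proof. by rewrite /enc_list /= !catA. Qed.

Section Letters.
Variable Sigma : finType.

(** The code of numbers is prefix-free, so a symbol is recognised exactly when its code is
    complete. *)
Lemma enc_sym_prefix (a b : Sigma) s : enc_sym a ++ s = enc_sym b -> a = b /\ s = [::].
Proof.
rewrite -[enc_sym b]cats0 => /enc_bits_inj[e ->]; split=> //.
by apply/enum_rank_inj/val_inj; rewrite -[LHS]bits_val_nat e bits_val_nat.
Qed.

(** For an atom in the rule of a symbol: the symbol, the required and the
    possible symbols of the atom, whether the atom may be absent, and whether it
    may be present; the last datum is [None] as long as it depends on comparing
    the bounds of the interval. *)
Definition entry : finType :=
  (Sigma * {set Sigma} * {set Sigma} * bool * option bool)%type.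

Definition entry_row (i : entry) (c : bool) : Sigma * row Sigma :=
  let: (a, R, U, z, o) := i in (a, (R, U, z, odflt c o)).

(** [Bit false] and [Bit true] carry the binary digits of the lower and of the
    upper bound of the interval described by the next [Entry]; the boolean of
    [Entry] is the result of the comparison of the digits consumed so far.
    [Open e X] starts a query node reached by an edge of kind [e] whose possible
    images are in [X]; [Value Y] is a query node already evaluated to the
    set [Y] of possible images of its parent. *)
Inductive letter :=
  | Mark of Sigma
  | Bit of bool & bool
  | Entry of entry & bool
  | Open of option bool & {set Sigma}
  | Close
  | Value of {set Sigma}.

Definition letter_code (g : letter) :
    Sigma + (bool * bool) + (entry * bool) + (option bool * {set Sigma}) + unit + {set Sigma} :=
  match g with
  | Mark a => inl (inl (inl (inl (inl a))))
  | Bit k b => inl (inl (inl (inl (inr (k, b)))))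
  | Entry i c => inl (inl (inl (inr (i, c))))
  | Open e X => inl (inl (inr (e, X)))
  | Close => inl (inr tt)
  | Value Y => inr Y
  end.

Definition letter_decode c : letter :=
  match c with
  | inl (inl (inl (inl (inl a)))) => Mark a
  | inl (inl (inl (inl (inr (k, b))))) => Bit k b
  | inl (inl (inl (inr (i, c)))) => Entry i c
  | inl (inl (inr (e, X))) => Open e X
  | inl (inr tt) => Close
  | inr Y => Value Y
  end.

Lemma letter_codeK : cancel letter_code letter_decode. Proof. by case. Qed.

HB.instance Definition _ := Finite.copy letter (can_type letter_codeK).

Let L := \max_(a : Sigma) size (enc_sym a).
Let N := #|Sigma|.

(** The symbol of the rule being read, the symbols of the remaining rules, and
    the last four components of the entry being read. *)
Definition context : finType :=
  (Sigma * {bseq N of Sigma} * {set Sigma} * {set Sigma} * bool * option bool)%type.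

(** The second argument of [PSym] tells what the symbol is for: the root of the schema, an atom in a
    given context, or the label of a query node with a given incoming edge. *)
Inductive pstate :=
  | PSym of {bseq L of bool} & (unit + context + option bool)
  | PRules of {bseq N of Sigma}
  | PAtoms of Sigma & {bseq N of Sigma}
  | PAtom of context
  | PFlag of context & Sigma
  | PLo of context
  | PLoBit of context
  | PHiOpt of context
  | PHi of context
  | PHiBit of context
  | POpt of context
  | PLab of option bool
  | PKids
  | PEdge.

Definition pstate_repr : finType :=
  (({bseq L of bool} * (unit + context + option bool)) + {bseq N of Sigma} +
   (Sigma * {bseq N of Sigma}) + (context * Sigma) +
   ('I_7 * context) + option bool + bool)%type.

Definition pstate_code (q : pstate) : pstate_repr :=
  match q with
  | PSym u k => inl (inl (inl (inl (inl (inl (u, k))))))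
  | PRules r => inl (inl (inl (inl (inl (inr r)))))
  | PAtoms a r => inl (inl (inl (inl (inr (a, r)))))
  | PFlag x a => inl (inl (inl (inr (x, a))))
  | PAtom x => inl (inl (inr (inord 0, x)))
  | PLo x => inl (inl (inr (inord 1, x)))
  | PLoBit x => inl (inl (inr (inord 2, x)))
  | PHiOpt x => inl (inl (inr (inord 3, x)))
  | PHi x => inl (inl (inr (inord 4, x)))
  | PHiBit x => inl (inl (inr (inord 5, x)))
  | POpt x => inl (inl (inr (inord 6, x)))
  | PLab e => inl (inr e)
  | PKids => inr true
  | PEdge => inr false
  end.

Definition pstate_decode (c : pstate_repr) : pstate :=
  match c with
  | inl (inl (inl (inl (inl (inl (u, k)))))) => PSym u k
  | inl (inl (inl (inl (inl (inr r))))) => PRules r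
  | inl (inl (inl (inl (inr (a, r))))) => PAtoms a r
  | inl (inl (inl (inr (x, a)))) => PFlag x a
  | inl (inl (inr (n, x))) =>
      nth PAtom [:: PAtom; PLo; PLoBit; PHiOpt; PHi; PHiBit; POpt] n x
  | inl (inr e) => PLab e
  | inr true => PKids
  | inr false => PEdge
  end.

Lemma pstate_codeK : cancel pstate_code pstate_decode.
Proof. by case=> //= x; rewrite inordK. Qed.

HB.instance Definition _ := Finite.copy pstate (can_type pstate_codeK).

Definition after_sym (k : unit + context + option bool) (a : Sigma) : pstate * seq letter :=
  match k with
  | inl (inl _) => (PRules (insub_bseq N (enum Sigma)), [:: Mark a])
  | inl (inr x) => (PFlag x a, [::])
  | inr e => (PKids, [:: Open e [set a]])
  end.

Definition no_bits : {bseq L of bool} := [bseq].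

(** A finite upper bound is first taken for 0, hence [Some false], until a digit defers the decision
    by [None]; an infinite one gives [Some true]. Likewise the lower bound counts as 0 until a digit
    appears. *)
Definition pstep (q : pstate) (b : bool) : pstate * seq letter :=
  match q with
  | PSym u k =>
      let u' := rcons u b in
      if [pick a | enc_sym a == u'] is Some a then after_sym k a
      else (PSym (insub_bseq L u') k, [::])
  | PRules r =>
      if b then if (r : seq Sigma) is a :: r' then (PAtoms a (insub_bseq N r'), [::])
                else (q, [::])
      else (PLab None, [::])
  | PAtoms a r => (if b then PAtom (a, r, set0, set0, true, None) else PRules r, [::])
  | PAtom x => (if b then PSym no_bits (inl (inr x)) else PLo x, [::])
  | PFlag (a, r, R, U, z, o) s =>
      (PAtom (a, r, if b then R else s |: R, s |: U, z, o), [::])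
  | PLo x => (if b then PLoBit x else PHiOpt x, [::])
  | PLoBit (a, r, R, U, z, o) => (PLo (a, r, R, U, false, o), [:: Bit false b])
  | PHiOpt (a, r, R, U, z, o) =>
      (if b then PHi (a, r, R, U, z, Some false) else POpt (a, r, R, U, z, Some true), [::])
  | PHi x => (if b then PHiBit x else POpt x, [::])
  | PHiBit (a, r, R, U, z, o) => (PHi (a, r, R, U, z, None), [:: Bit true b])
  | POpt (a, r, R, U, z, o) => (PAtoms a r, [:: Entry (a, R, U, z || b, o) true])
  | PLab e => if b then (PSym no_bits (inr e), [::]) else (PKids, [:: Open e setT])
  | PKids => if b then (PEdge, [::]) else (PKids, [:: Close])
  | PEdge => (PLab (Some b), [::])
  end.

Notation parse := (transduce pstep).

Lemma size_parse q s : size (parse q s) <= size s.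
Proof.
elim: s q => //= b s IHs q; rewrite size_cat -add1n leq_add //.
case: q => /= [u k|r|a r|x|[[[[[a r] R] U] z] o] c|x|[[[[[a r] R] U] z] o]|[[[[[a r] R] U] z] o]
             |x|[[[[[a r] R] U] z] o]|[[[[[a r] R] U] z] o]|e||] //; try by case: b.
  by case: pickP => [a _|_] //; case: k => [[?|?]|?].
by case: b => //; case: r => -[|a r].
Qed.

Lemma parse_sym a k s :
  parse (PSym no_bits k) (enc_sym a ++ s) =
  (after_sym k a).2 ++ parse (after_sym k a).1 s.
Proof.
suff H p r (u : {bseq L of bool}) : u = p :> seq bool -> p ++ r = enc_sym a -> r != [::] ->
    parse (PSym u k) (r ++ s) = (after_sym k a).2 ++ parse (after_sym k a).1 s.
  apply: (H [::]) => //; rewrite /enc_sym /enc_nat -size_eq0 size_cat addn1 //.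
elim: r p u => // b r IHr p u eu ep _; rewrite /= eu.
case: pickP => [a' /eqP ea|np].
  (* The buffer equals the code of [a'] and begins the code of [a]; prefix-freeness makes it the
     whole code. *)
  have [ea' er] : a' = a /\ r = [::] by apply: enc_sym_prefix; rewrite ea cat_rcons.
  by rewrite ea' er.
rewrite /= (IHr (rcons p b)) //; first last.
- by apply/eqP => er; have := np a; rewrite -ep er cats1 eqxx.
- by rewrite cat_rcons.
rewrite insub_bseqE //.
apply: leq_trans (leq_bigmax (F := fun a => size (enc_sym a)) a).
by rewrite -ep size_rcons size_cat /= addnS ltnS leq_addr.
Qed.

Lemma parse_atom (A : atom Sigma) a r R U z o s :
  parse (PAtom (a, r, R, U, z, o)) (enc_atom A ++ s) =
  parse (PLo (a, r, R :|: reqs A, U :|: syms A, z, o)) s.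
Proof.
elim: A R U => [|[b f] A IHA] R U.
  have -> : R :|: reqs [::] = R by apply/setP => c; rewrite !inE orbF.
  by have -> : U :|: syms [::] = U by apply/setP => c; rewrite !inE orbF.
rewrite /enc_atom enc_list_cons -(catA (enc_sym _)) /= parse_sym /= IHA.
congr (parse (PLo (_, _, _, _, _, _)) _); apply/setP => c.
  by case: f; rewrite !inE xpair_eqE ?andbF ?andbT //=; case: (c == b); rewrite ?orbT.
by rewrite !inE /=; case: (c == b); rewrite ?orbT.
Qed.

Lemma parse_lo l a r R U z o s :
  parse (PLo (a, r, R, U, z, o)) (enc_bits l ++ s) =
  map (Bit false) l ++ parse (PHiOpt (a, r, R, U, nilp l && z, o)) s.
Proof. by elim: l z => // b l IHl z; rewrite /= (IHl false) andbF. Qed.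

Lemma parse_hi l a r R U z o s :
  parse (PHi (a, r, R, U, z, o)) (enc_bits l ++ s) =
  map (Bit true) l ++ parse (POpt (a, r, R, U, z, if nilp l then o else None)) s.
Proof. by elim: l o => // b l IHl o; rewrite /= (IHl None) if_same. Qed.

(** The digits of both bounds of an interval, and its entry with the current
    result of the comparison. *)
Definition item : Type := (seq bool * seq bool * entry * bool)%type.

Definition item_letters (x : item) : seq letter :=
  let: (l, h, i, c) := x in map (Bit false) l ++ map (Bit true) h ++ [:: Entry i c].

Definition items_letters (xs : seq item) : seq letter := flatten (map item_letters xs).

(** The comparison starts at [true], as bounds without digits are equal. An upper bound 0 is settled
    at once, since it excludes any positive number of copies. *)
Definition item_of (a : Sigma) (AI : atom Sigma * interval) : item :=
  let: (A, J) := AI in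
  (nat_bits (ilo J), if ihi J is Some m then nat_bits m else [::],
   (a, reqs A, syms A, (ilo J == 0) || iopt J,
    if ihi J is Some m then (if m == 0 then Some false else None) else Some true), true).

Definition schema_items (S : IMS Sigma) : seq item :=
  flatten [seq map (item_of a) (ims_rules S a) | a <- enum Sigma].

Lemma items_letters_cat xs ys :
  items_letters (xs ++ ys) = items_letters xs ++ items_letters ys.
Proof. by rewrite /items_letters map_cat flatten_cat. Qed.

Lemma items_letters_cons l h i c xs s :
  items_letters ((l, h, i, c) :: xs) ++ s =
  map (Bit false) l ++ map (Bit true) h ++ Entry i c :: items_letters xs ++ s.
Proof. by rewrite /items_letters /= -!catA. Qed.

Lemma parse_ime a r (E : ime Sigma) s :
  parse (PAtoms a r) (enc_ime E ++ s) =
  items_letters (map (item_of a) E) ++ parse (PRules r) s.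
Proof.
elim: E => [|[A [lo hi o]] E IHE] //.
rewrite /enc_ime enc_list_cons /= -/(enc_ime E) -(catA (enc_atom A)) parse_atom !set0U.
rewrite /enc_interval -(catA (enc_nat lo)) -(catA (enc_opt _ _)) enc_natE parse_lo.
rewrite nilp_nat_bits andbT items_letters_cons /=; congr (_ ++ _).
case: hi => [m|] /=; last by rewrite IHE.
by rewrite enc_natE parse_hi nilp_nat_bits /= IHE; case: (m == 0).
Qed.

(** The encoding does not name the left sides of the rules; [r] lists those still to come, in the
    order of [enum]. *)
Lemma parse_rules (rules : Sigma -> ime Sigma) (r : {bseq N of Sigma}) s :
  parse (PRules r) (enc_list (fun a => enc_ime (rules a)) r ++ s) =
  items_letters (flatten [seq map (item_of a) (rules a) | a <- (r : seq Sigma)]) ++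
  parse (PLab None) s.
Proof.
move er: (r : seq Sigma) => l; elim: l r er => [|a l IHl] r er; first by [].
rewrite enc_list_cons /= er parse_ime /= items_letters_cat -catA.
have el : insub_bseq N l = l :> seq Sigma.
  by rewrite insub_bseqE //; apply: ltnW; rewrite -[_ < _]/(size (a :: l) <= N) -er size_bseq.
by rewrite -(IHl _ el).
Qed.

Fixpoint twig_letters (e : option bool) (q : twig Sigma) : seq letter :=
  let: QNode l cs := q in
  Open e (labels l) ::
    flatten (map (fun c => twig_letters (Some c.1) c.2) cs) ++ [:: Close].

Lemma parse_twig q e s : parse (PLab e) (enc_twig q ++ s) = twig_letters e q ++ parse PKids s.
Proof.
elim/twig_nth_ind: q e s => l cs IHq e s.
have kids t : parse PKids ((fix encs (cs : seq (bool * twig Sigma)) : seq bool :=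
     match cs with
     | [::] => [:: false]
     | (b, q') :: cs' => true :: b :: enc_twig q' ++ encs cs'
     end) cs ++ t) =
   flatten (map (fun c => twig_letters (Some c.1) c.2) cs) ++ Close :: parse PKids t.
  elim: cs IHq => [|[b q'] cs IHcs] IHq //=.
  rewrite -catA (IHq 0 (b, q') isT) IHcs ?catA // => i d lti.
  exact: (IHq i.+1 d).
case: l => [a|] /=; last by rewrite kids -catA.
by rewrite -(catA (enc_sym a)) parse_sym /= kids -catA.
Qed.

Lemma parse_instance (x : IMS Sigma * twig Sigma) :
  parse (PSym no_bits (inl (inl tt))) (enc_instance x) =
  Mark (ims_root x.1) :: items_letters (schema_items x.1) ++ twig_letters None x.2.
Proof.
rewrite /enc_instance /enc_IMS -(catA (enc_sym _)) parse_sym /=; congr (_ :: _).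
have eN : insub_bseq N (enum Sigma) = enum Sigma :> seq Sigma.
  by rewrite insub_bseqE // /N cardE.
have := parse_rules (ims_rules x.1) (insub_bseq N (enum Sigma)) (enc_twig x.2).
by rewrite eN => ->; rewrite -[enc_twig x.2]cats0 parse_twig /= cats0.
Qed.

End Letters.

(** * Evaluating the tokens *)

Section Evaluator.
Variable Sigma : finType.

Definition table : finType := {set Sigma * row Sigma}.

Variables (edge : table -> rel Sigma) (answer : table -> Sigma -> {set Sigma} -> bool).

Local Notation open_node := (option bool * {set Sigma})%type.

(** In [Compare], the first flag records whether a digit was consumed in this pass, and [d] and [e]
    are the digits taken from the two current bounds. [Reduce] may withhold the latest open node. *)
Inductive estate :=
  | Compare of bool & option bool & option bool & table
  | Begin of Sigma & table
  | Reduce of table & option open_node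
  | Done of bool.

Definition estate_code (q : estate) :
    (bool * option bool * option bool * table) + (Sigma * table) +
    (table * option open_node) + bool :=
  match q with
  | Compare ch d e K => inl (inl (inl (ch, d, e, K)))
  | Begin a K => inl (inl (inr (a, K)))
  | Reduce K p => inl (inr (K, p))
  | Done v => inr v
  end.

Definition estate_decode c : estate :=
  match c with
  | inl (inl (inl (ch, d, e, K))) => Compare ch d e K
  | inl (inl (inr (a, K))) => Begin a K
  | inl (inr (K, p)) => Reduce K p
  | inr v => Done v
  end.

Lemma estate_codeK : cancel estate_code estate_decode. Proof. by case. Qed.

HB.instance Definition _ := Finite.copy estate (can_type estate_codeK).

(** Digits arrive least significant first, so two distinct digits override the earlier result [c];
    an exhausted bound supplies zeros. *)
Definition bit_compare (d e : option bool) (c : bool) : bool :=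
  if odflt false d == odflt false e then c else odflt false e.

Definition node_value K (e : option bool) (X : {set Sigma}) : {set Sigma} :=
  if e is Some k then parents (edge K) k X else X.

Definition pending (p : option open_node) : seq (letter Sigma) :=
  if p is Some (e, X) then [:: Open e X] else [::].

(** In [Reduce], the withheld [Open] absorbs the values that follow; a [Close] turns it into a
    value, and another [Open] releases it. [Begin] erases what remains of the schema. *)
Definition estep (q : estate) (g : letter Sigma) : estate * seq (letter Sigma) :=
  match q with
  | Compare ch d e K =>
      match g with
      | Mark a => (if ch then Compare false None None set0 else Begin a K, [:: g])
      | Bit false b => if d is None then (Compare true (Some b) e K, [::]) else (q, [:: g])
      | Bit true b => if e is None then (Compare true d (Some b) K, [::]) else (q, [:: g])
      | Entry i c => let c' := bit_compare d e c in
          (Compare ch None None (entry_row i c' |: K), [:: Entry i c'])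
      | _ => (q, [:: g])
      end
  | Begin a K =>
      match g with
      | Open e X => (Reduce K (Some (e, X)), [::])
      | Value Y => (Done (answer K a Y), [::])
      | _ => (q, [::])
      end
  | Reduce K p =>
      match g with
      | Mark a => (Begin a K, pending p ++ [:: g])
      | Open e X => (Reduce K (Some (e, X)), pending p)
      | Close => (Reduce K None,
                  [:: if p is Some (e, X) then Value (node_value K e X) else g])
      | Value Y => if p is Some (e, X) then (Reduce K (Some (e, X :&: Y)), [::])
                   else (q, [:: g])
      | _ => (q, [::])
      end
  | Done v => (q, [::])
  end.

Definition everdict (q : estate) : option bool := if q is Done v then Some v else None.

Notation qstep := (queue_step estep everdict).

Fixpoint pass (q : estate) (s : seq (letter Sigma)) : estate * seq (letter Sigma) :=
  if s is g :: s' then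
    ((pass (estep q g).1 s').1, (estep q g).2 ++ (pass (estep q g).1 s').2)
  else (q, [::]).

Lemma pass_cat q s t :
  pass q (s ++ t) = ((pass (pass q s).1 t).1, (pass q s).2 ++ (pass (pass q s).1 t).2).
Proof. by elim: s q => [|g s IHs] q /=; [case: pass | rewrite IHs /= catA]. Qed.

Lemma iter_pass q s t : everdict (pass q s).1 = None ->
  iter (size s) qstep (q, s ++ t) = ((pass q s).1, t ++ (pass q s).2).
Proof.
elim: s q t => [|g s IHs] q t; first by rewrite cats0.
move=> vq; rewrite [size _]/= iterSr /queue_step /=.
(* A pass never leaves [Done], so no verdict at the end means none at the start. *)
have -> : everdict q = None.
  case: q vq => //= v; suff -> : pass (Done v) s = (Done v, [::]) by [].
  by elim: (s) => //= g' s' ->.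
by rewrite -/qstep -catA IHs // catA.
Qed.

Definition halts (q : estate) (s : seq (letter Sigma)) (v : bool) (n : nat) : Prop :=
  exists2 m, m <= n & everdict (iter m qstep (q, s)).1 = Some v.

Lemma halts_leq q s v m n : m <= n -> halts q s v m -> halts q s v n.
Proof. by move=> mn [k km kv]; exists k => //; apply: leq_trans mn. Qed.

Lemma halts_pass q s t v n : everdict (pass q s).1 = None ->
  halts (pass q s).1 (t ++ (pass q s).2) v n -> halts q (s ++ t) v (size s + n).
Proof.
move=> vq [m mn mv]; exists (m + size s); first by rewrite addnC leq_add2l.
by rewrite iterD iter_pass.
Qed.

(** Reads a partially evaluated query, with the stack of the nodes still open. *)
Fixpoint evaluate K (stk : seq open_node) (s : seq (letter Sigma)) : option {set Sigma} :=
  match s with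
  | Open e X :: s' => evaluate K ((e, X) :: stk) s'
  | Close :: s' =>
      match stk with
      | (e, X) :: (e', X') :: stk' =>
          evaluate K ((e', X' :&: node_value K e X) :: stk') s'
      | [:: (e, X)] => Some (node_value K e X)
      | [::] => None
      end
  | Value Y :: s' =>
      match stk with
      | (e', X') :: stk' => evaluate K ((e', X' :&: Y) :: stk') s'
      | [::] => Some Y
      end
  | _ => None
  end.

Definition in_query (g : letter Sigma) : bool :=
  match g with Open _ _ | Close | Value _ => true | _ => false end.

(** If a node is pending at the start, one is pending until the first [Close], which merges with it
    into a single letter; this gives the strict decrease. *)
Lemma pass_reduce K p s : all in_query s ->
  exists p' out,
    [/\ pass (Reduce K p) s = (Reduce K p', out),
        forall stk, evaluate K stk (out ++ pending p') = evaluate K stk (pending p ++ s),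
        all in_query out,
        size (out ++ pending p') <= size (pending p ++ s) &
        p -> Close _ \in s -> size (out ++ pending p') < size (pending p ++ s)].
Proof.
elim: s p => [|g s IHs] p /=.
  by exists p, [::]; rewrite cats0; split.
case: g => // [e X|  |Y] /= qs.
- have [p' [out [-> He Hq Hs Hc]]] := IHs (Some (e, X)) qs.
  exists p', (pending p ++ out); split=> //.
  + by move=> stk; case: p => [[e' X']|] /=; rewrite He.
  + by rewrite all_cat Hq andbT; case: p => // -[].
  + by rewrite -catA !size_cat leq_add2l -size_cat (leq_trans Hs).
  + move=> _; rewrite inE => /= cs.
    by rewrite -catA !size_cat ltn_add2l -size_cat; apply: Hc.
- have [p' [out [-> He Hq Hs _]]] := IHs None qs.
  exists p', ((if p is Some (e, X) then Value (node_value K e X) else Close _) :: out); split=> //.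
  + move=> stk; case: p => [[e X]|] /=.
      by case: stk => [|[e' X'] stk] //; rewrite He.
    by case: stk => [|[e X] [|[e' X'] stk]] //; rewrite He.
  + by rewrite /= Hq andbT; case: p => // -[].
  + by case: p => [[e X]|] /=; rewrite ltnS // leqW.
  + by case: p => [[e X]|] //= _ _; rewrite !ltnS.
- case: p => [[e X]|] /=.
    have [p' [out [-> He Hq Hs _]]] := IHs (Some (e, X :&: Y)) qs.
    rewrite /= in Hs; exists p', out; split=> //.
    exact: leqW.
  have [p' [out [-> He Hq Hs _]]] := IHs None qs.
  exists p', (Value Y :: out); split=> //= stk.
  by case: stk => [|[e X] stk] //; rewrite He.
Qed.

Lemma evaluate_open K stk s : stk != [::] -> all in_query s -> Close _ \notin s ->
  evaluate K stk s = None.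
Proof.
elim: s stk => [|[a|k b|i c|e X||Y] s IHs] [|[e' X'] stk] //= _ qs; rewrite inE => /= cs;
  exact: IHs.
Qed.

(** Each pass takes at most [m.+1] steps and removes a letter, until a single value is left in front
    of the mark. *)
Lemma halts_reduce a K Y s m : all in_query s -> evaluate K [::] s = Some Y -> size s <= m ->
  halts (Begin a K) (s ++ [:: Mark a]) (answer K a Y) ((size s).+1 * m.+1).
Proof.
elim/ltn_ind: {s}(size s) {-2}s (erefl (size s)) => n IHn [|g s] en //= qs ev sm.
case: g en qs ev sm => //= [e X|Z] en qs ev sm; last first.
  by case: ev => <-; exists 1 => //; rewrite -en.
have [p' [out [Hp He Hq Hs Hc]]] := pass_reduce K (Some (e, X)) qs.
have cs : Close _ \in s.
  by apply/negPn/negP => ncs; rewrite (evaluate_open K _ qs ncs) in ev.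
have {}Hc := Hc isT cs; rewrite /= in Hc.
have -> : Open e X :: s ++ [:: Mark a] = (Open e X :: s ++ [:: Mark a]) ++ [::].
  by rewrite cats0.
have ep : pass (Begin a K) (Open e X :: s ++ [:: Mark a]) =
          (Begin a K, (out ++ pending p') ++ [:: Mark a]).
  by rewrite /= pass_cat Hp /= cats0 catA.
rewrite /= in en.
apply: halts_leq (halts_pass (n := (size (out ++ pending p')).+1 * m.+1) _ _).
- by rewrite /= size_cat addn1; move: (size (out ++ _)) Hc => x Hc; nia.
- by rewrite ep.
rewrite ep /=; apply: (IHn (size (out ++ pending p'))) => //.
- by rewrite -en.
- by rewrite all_cat Hq; case: (p') => // -[].
- by rewrite He.
- by apply: leq_trans sm; apply: ltnW.
Qed.

(** * Comparison of interval bounds, one digit per pass *)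

Definition item_step (x : item Sigma) : item Sigma :=
  let: (l, h, i, c) := x in
  (behead l, behead h, i, bit_compare (Some (head false l)) (Some (head false h)) c).

Definition digits (xs : seq (item Sigma)) : nat :=
  sumn [seq size x.1.1.1 + size x.1.1.2 | x <- xs].

Definition item_row (x : item Sigma) : Sigma * row Sigma := entry_row x.1.2 x.2.

Definition items_table (xs : seq (item Sigma)) : table := [set r in map item_row xs].

Lemma pass_lower ch b e K l :
  pass (Compare ch (Some b) e K) (map (Bit _ false) l) =
  (Compare ch (Some b) e K, map (Bit _ false) l).
Proof. by elim: l => //= c l ->. Qed.

Lemma pass_upper ch d b K l :
  pass (Compare ch d (Some b) K) (map (Bit _ true) l) =
  (Compare ch d (Some b) K, map (Bit _ true) l).
Proof. by elim: l => //= c l ->. Qed.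

Lemma pass_item ch K x :
  pass (Compare ch None None K) (item_letters x) =
  (Compare (ch || (0 < digits [:: x])) None None (item_row (item_step x) |: K),
   item_letters (item_step x)).
Proof.
case: x => [[[l h] i] c]; rewrite /item_letters /digits /= addn0.
have [d Hl ed] : exists2 d, pass (Compare ch None None K) (map (Bit _ false) l) =
    (Compare (ch || (0 < size l)) d None K, map (Bit _ false) (behead l)) &
    odflt false d = head false l.
  case: l => [|b l]; first by exists None; rewrite ?orbF.
  by exists (Some b); rewrite //= pass_lower orbT.
have [e Hh ee] : exists2 e, pass (Compare (ch || (0 < size l)) d None K) (map (Bit _ true) h) =
    (Compare (ch || (0 < size l) || (0 < size h)) d e K, map (Bit _ true) (behead h)) &
    odflt false e = head false h.
  case: h => [|b h]; first by exists None; rewrite ?orbF.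
  by exists (Some b); rewrite //= pass_upper orbT.
by rewrite !pass_cat Hl Hh /= addn_gt0 orbA /bit_compare ed ee.
Qed.

Lemma pass_items ch K xs :
  pass (Compare ch None None K) (items_letters xs) =
  (Compare (ch || (0 < digits xs)) None None (items_table (map item_step xs) :|: K),
   items_letters (map item_step xs)).
Proof.
elim: xs ch K => [|x xs IHxs] ch K.
  rewrite /= orbF; congr (Compare _ _ _ _, _).
  by apply/setP => r; rewrite !inE.
rewrite [items_letters _]/= pass_cat pass_item /= IHxs /=.
congr (Compare _ _ _ _, _); first by rewrite -orbA; congr (ch || _); rewrite /digits /=; lia.
by apply/setP => r; rewrite !inE /= orbCA orbA.
Qed.

Lemma pass_query ch K s : all in_query s ->
  pass (Compare ch None None K) s = (Compare ch None None K, s).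
Proof. by elim: s => //= -[a|k b|i c|e X||Y] s IHs //= /IHs->. Qed.

Definition item_le (x : item Sigma) : Sigma * row Sigma :=
  let: (l, h, i, c) := x in
  entry_row i ((bits_val l < bits_val h) || ((bits_val l == bits_val h) && c)).

(** A bound is its first digit plus twice the rest: the rests decide unless equal, then the digits,
    and only then [c]. *)
Lemma item_le_step x : item_le (item_step x) = item_le x.
Proof.
case: x => [[[l h] i] c] /=; congr entry_row.
have eb s : bits_val s = head false s + 2 * bits_val (behead s) by case: s.
rewrite [bits_val l]eb [bits_val h]eb /bit_compare /=.
case: (head false l) (head false h) => -[] /=; case: c; lia.
Qed.

Lemma items_letters_size_step xs :
  size (items_letters (map item_step xs)) <= size (items_letters xs).
Proof.
elim: xs => //= -[[[l h] i] c] xs IHxs; rewrite /items_letters /= in IHxs *.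
by rewrite !size_cat /= !size_map !size_behead; lia.
Qed.

Lemma digits_step xs : 0 < digits xs -> digits (map item_step xs) < digits xs.
Proof.
have le ys : digits (map item_step ys) <= digits ys.
  elim: ys => //= -[[[l h] i] c] ys IHys; rewrite /digits /= in IHys *.
  by rewrite !size_behead; lia.
have cons x ys : digits (x :: ys) = size x.1.1.1 + size x.1.1.2 + digits ys by [].
elim: xs => //= -[[[l h] i] c] xs IHxs; rewrite !cons /= !size_behead.
have := le xs; case: (posnP (digits xs)) => [->|/IHxs]; lia.
Qed.

Lemma item_row_step xs : digits xs = 0 -> map item_row (map item_step xs) = map item_le xs.
Proof.
elim: xs => //= -[[[l h] i] c] xs IHxs /eqP.
rewrite /digits /= !addn_eq0 !size_eq0 => /andP[/andP[/eqP-> /eqP->] /eqP/IHxs->].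
by rewrite /item_row /bit_compare.
Qed.

Lemma pass_begin a K xs : pass (Begin a K) (items_letters xs) = (Begin a K, [::]).
Proof.
elim: xs => //= -[[[l h] i] c] xs IHxs.
rewrite /items_letters /= -/(items_letters _) !pass_cat.
have skip f (s : seq bool) : pass (Begin a K) (map (Bit _ f) s) = (Begin a K, [::]).
  by elim: s => //= b s ->.
by rewrite skip /= skip /= IHxs.
Qed.

(** The summands pay for the passes that compare, each but the last consuming a digit, for erasing
    the items, and for reducing the query. *)
Lemma halts_compare a Y xs s m : all in_query s ->
  evaluate [set r in map item_le xs] [::] s = Some Y ->
  size (items_letters xs) + size s <= m ->
  halts (Compare false None None set0) (items_letters xs ++ s ++ [:: Mark a])
    (answer [set r in map item_le xs] a Y)
    ((digits xs).+1 * m.+1 + m + m.+1 * m.+1).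
Proof.
move: {2}(digits xs).+1 (ltnSn (digits xs)) => n.
elim: n xs => // n IHn xs; rewrite ltnS => dn qs ev sm.
have eK : [set r in map item_le (map item_step xs)] = [set r in map item_le xs] :> table.
  by rewrite -map_comp (eq_map item_le_step).
have ep : pass (Compare false None None set0) (items_letters xs ++ s ++ [:: Mark a]) =
  (if 0 < digits xs then Compare false None None set0
   else Begin a (items_table (map item_step xs)),
   items_letters (map item_step xs) ++ s ++ [:: Mark a]).
  by rewrite !pass_cat pass_items /= pass_query //= setU0.
rewrite -[items_letters xs ++ s ++ _]cats0.
case: (posnP (digits xs)) => d0; last first.
  apply: halts_leq (halts_pass (n := (digits (map item_step xs)).+1 * m.+1 + m + m.+1 * m.+1) _ _).
  - have := digits_step d0; rewrite !size_cat /=.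
    move: (digits _) (digits _) sm => x y sm lt; nia.
  - by rewrite ep d0.
  rewrite ep d0 /= -eK; apply: IHn => //; rewrite ?eK //.
    by apply: leq_trans dn; apply: digits_step.
  by apply: leq_trans sm; rewrite leq_add2r items_letters_size_step.
apply: halts_leq (halts_pass (n := m + m.+1 * m.+1) _ _).
- by rewrite d0 mul1n -addnA leq_add2r !size_cat /= addn1 addnS ltnS.
- by rewrite ep d0.
rewrite ep d0 /= /items_table item_row_step // -[X in halts _ X]/(_ ++ (s ++ [:: Mark a])).
set K := [set r in _].
apply: halts_leq (halts_pass (n := (size s).+1 * m.+1) _ _).
- rewrite leq_add //; first apply: leq_trans (items_letters_size_step xs) _.
    exact: leq_trans (leq_addr _ _) sm.
  by rewrite leq_mul2r ltnS (leq_trans (leq_addl _ _) sm) orbT.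
- by rewrite pass_begin.
rewrite pass_begin cats0; apply: halts_reduce => //.
exact: leq_trans (leq_addl _ _) sm.
Qed.

Lemma in_query_twig e (q : twig Sigma) : all in_query (twig_letters e q).
Proof.
elim/twig_nth_ind: q e => l cs IHq e /=; rewrite all_cat andbT.
elim: cs IHq => //= c cs IHcs IHq; rewrite all_cat (IHq 0 c isT) IHcs // => i d.
exact: (IHq i.+1 d).
Qed.

(** Reading the children in turn intersects the node with their values, just as the [foldl] in
    [roots] does. *)
Lemma evaluate_twig K stk e (q : twig Sigma) s :
  evaluate K stk (twig_letters e q ++ s) =
  evaluate K stk (Value (node_value K e (roots (edge K) q)) :: s).
Proof.
elim/twig_nth_ind: q e stk s => l cs IHq e stk s /=; rewrite -catA.
have kids X t : evaluate K ((e, X) :: stk)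
    (flatten [seq twig_letters (Some c.1) c.2 | c <- cs] ++ t) =
  evaluate K ((e, foldl (fun X c => X :&: parents (edge K) c.1 (roots (edge K) c.2)) X cs)
              :: stk) t.
  elim: cs X IHq => //= c cs IHcs X IHq; rewrite -catA (IHq 0 c isT) /= IHcs // => i d.
  exact: (IHq i.+1 d).
by rewrite kids /=; case: stk {kids} => [|[e' X'] stk].
Qed.

(** Common to both problems, which differ only in the graph and in the final test computed from the
    table. *)
Lemma table_machine_PTIME (P : IMS Sigma * twig Sigma -> Prop) :
  (forall S q, wf_IMS S ->
     P (S, q) <-> answer [set r in map item_le (schema_items S)] (ims_root S)
       (roots (edge [set r in map item_le (schema_items S)]) q)) ->
  in_PTIME enc_instance (fun x => wf_IMS x.1) P.
Proof.
move=> HP.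
pose T m := (m + 1) * (m + 1) + m + (m + 1) * (m + 1) + 1.
apply: (@in_PTIME_queue _ _ _ (@pstep Sigma) (PSym (no_bits Sigma) (inl (inl tt)))
          estep (Compare true None None set0) everdict _ _ _ _ T).
  have cst := poly_bounded_const; have idp := poly_bounded_id.
  by do ?[exact: cst | exact: idp | apply: poly_bounded_add | apply: poly_bounded_mul].
move=> [S q] /= wS; set m := size _; set K := [set r in map item_le (schema_items S)].
have szm := size_parse (PSym (no_bits Sigma) (inl (inl tt))) (enc_instance (S, q)).
rewrite parse_instance /= size_cat -/m in szm *.
have ev : evaluate K [::] (twig_letters None q) = Some (roots (edge K) q).
  by rewrite -[twig_letters _ _]cats0 evaluate_twig.
have [n nle nv] := halts_compare (ims_root S) (in_query_twig None q) ev (leqnn _).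
(* The extra step moves the root mark from the front to the end of the queue. *)
exists n.+1, (answer K (ims_root S) (roots (edge K) q)); split.
- have : digits (schema_items S) <= size (items_letters (schema_items S)).
    elim: (schema_items S) => // -[[[l h] i] c] xs IHxs.
    by rewrite -[items_letters _]cats0 items_letters_cons cats0 /digits /= -/(digits xs)
      !size_cat /= !size_map; lia.
  move: nle szm; rewrite /T.
  move: (digits _) (size (items_letters _)) (size (twig_letters _ _)) => x y z nle szm xy.
  rewrite addn1 ltnS (leq_trans nle) // !addn1.
  have km : (y + z).+1 <= m.+1 by apply: leqW.
  by rewrite !leq_add ?leq_mul //; lia.
- by rewrite iterSr /queue_step /= -catA.
- by rewrite HP.
Qed.

End Evaluator.

(** * Agreement of the computed table with the schema *)

Section Characterization.
Variable Sigma : finType.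

Definition table_family (K : table Sigma) (a : Sigma) : {set {set Sigma}} :=
  family [set r | (a, r) \in K].

Lemma item_le_row a (AI : atom Sigma * interval) :
  item_le (item_of a AI) = (a, row_of AI).
Proof.
case: AI => A [lo hi o]; rewrite /row_of /some_ok /= andbT !bits_val_nat.
case: hi => [m|] //=; rewrite bits_val_nat.
case: (posnP m) => [->|m0] /=; first by rewrite andbF.
by rewrite andbT [lo <= m]leq_eqVlt [(lo < m) || _]orbC.
Qed.

Lemma schema_table_family (S : IMS Sigma) a :
  table_family [set r in map (@item_le Sigma) (schema_items S)] a = family (rows (ims_rules S a)).
Proof.
congr family; apply/setP => r; rewrite !inE /schema_items map_flatten -map_comp.
have -> : [seq (map (@item_le Sigma) \o (fun b => map (item_of b) (ims_rules S b))) b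
              | b <- enum Sigma]
        = [seq map (fun AI => (b, row_of AI)) (ims_rules S b) | b <- enum Sigma].
  by apply: eq_map => b /=; rewrite -map_comp; apply: eq_map => AI /=; apply: item_le_row.
apply/flattenP/mapP => [[s /mapP[b _ ->] /mapP[AI AIb [-> ->]]]|[AI AIa ->]].
  by exists AI.
exists [seq (a, row_of AI) | AI <- ims_rules S a]; last by apply/mapP; exists AI.
by apply/mapP; exists a; rewrite ?mem_enum.
Qed.

End Characterization.

Theorem theorem5 (Sigma : finType) :
  in_PTIME (@enc_instance Sigma) (fun x => wf_IMS x.1) SAT_problem /\
  in_PTIME (@enc_instance Sigma) (fun x => wf_IMS x.1) IMPL_problem.
Proof.
have eqF (S : IMS Sigma) : table_family [set r in map (@item_le Sigma) (schema_items S)] =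
    (fun a => family (rows (ims_rules S a))).
  by apply: functional_extensionality => a; apply: schema_table_family.
split.
- apply: (@table_machine_PTIME _ (fun K => may_child (table_family K))
    (fun K a Y => (a \in productive (table_family K)) && (a \in Y))) => S q wS.
  by rewrite eqF; apply: SAT_characterization.
- apply: (@table_machine_PTIME _ (fun K => must_child (table_family K))
    (fun K a Y => (a \in productive (table_family K)) ==> (a \in Y))) => S q wS.
  by rewrite eqF; apply: IMPL_characterization.
Qed.
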